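(* Let $\gamma$ be an admissible vertex-oriented graph, let $n=|E(\gamma)|+1$ and $i=\sum_{x\in V(\gamma)}(|x|-1)$, and choose any basepoint $b$ on $C=\bigcup_x C_x$. Then the image of the cycle $z(\gamma)\in\mathfrak C_i(\mathrm{Aut}(F_n))$ (formed with basepoint $b$) under the stabilization map $$H_i(\mathrm{Aut}(F_n);\mathbb Q)\to H_i(\mathrm{Aut}(F_{n+1});\mathbb Q)$$ is null-homologous. That is, the chain $s(z(\gamma))$, where $s$ is the chain map adding a loop at the basepoint, is a boundary in the complex $\mathfrak C_*(\mathrm{Aut}(F_{n+1}))$.
   Context: Graphs are finite and may have loops and multiple edges; isomorphisms of graphs are taken to be bijections on vertices and half-edges preserving incidence and the pairing of half-edges into edges. A forest in $G$ is a subgraph (equivalently, a set of edges) containing no cycles. The complex for $\mathrm{Aut}(F_n)$. Consider triples $(G,b,F)$, where $G$ is a connected graph with first Betti number $n$, $b$ is a vertex of $G$ (the basepoint), every vertex other than $b$ has valence at least $3$ and $b$ has valence at least $2$, and $F\subset G$ is a forest. An orientation is an ordering of the edges of $F$ up to even permutation. $\mathfrak C_k(\mathrm{Aut}(F_n))$ is the $\mathbb Q$-vector space spanned by isomorphism classes (isomorphisms preserve basepoints, forests and orientations) of oriented triples with $|F|=k$ edges, modulo $(G,b,F)+(G,b,-F)=0$, where $-F$ denotes $F$ with the opposite orientation. If $F$ has ordered edges $e_1,\dots,e_k$, the boundary operator is $$\partial(G,b,F)=\sum_{i=1}^k(-1)^i\big((G,b,F-e_i)-(G_{e_i},b,F_{e_i})\big),$$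 where $(G_{e_i},b,F_{e_i})$ is the result of contracting the edge $e_i$, and the remaining forest edges keep their induced order. The homology of this complex (the chain complex of the quotient of the spine $L_n$ of Auter space by $\mathrm{Aut}(F_n)$) is $H_*(\mathrm{Aut}(F_n);\mathbb Q)$. The stabilization map $H_i(\mathrm{Aut}(F_n);\mathbb Q)\to H_i(\mathrm{Aut}(F_{n+1});\mathbb Q)$ is induced by the chain map $s$ which sends $(G,b,F)$ to $(G\cup\text{loop at }b,\,b,\,F)$. A graph $\gamma$ is admissible if it is connected and all its vertices have odd valence at least $3$; $|x|$ denotes the valence of a vertex $x$. An orientation at a vertex is an ordering of the half-edges incident to it, up to even permutation; $\gamma$ is vertex-oriented if every vertex has an orientation. The cycle $z(\gamma)$. For each vertex $x$ of $\gamma$ choose an ordering of the half-edges at $x$ representing the vertex-orientation, and let $C_x$ be an $|x|$-gon with cyclically ordered vertices $v_1,\dots,v_{|x|}$ and cyclically ordered edges $e_1,\dots,e_{|x|}$, where $e_i$ joins $v_{i-1}$ to $v_i$ (indices mod $|x|$). For a collection $\sigma=\{\sigma_x\}_{x\in V(\gamma)}$, $\sigma_x$ a permutation of $\{1,\dots,|x|\}$, let $G^\sigma$ be the graph obtained from $\gamma$ by removing each vertex $x$, inserting $C_x$, and attaching the $j$-th half-edge at $x$ to the vertex $v_{\sigma_x(j)}$ of $C_x$, for $j=1,\dots,|x|$. The graph $G^\sigma$ is connected, trivalent, and has first Betti number $|E(\gamma)|+1$. The basepoint $b$ on $C=\bigcup_xC_x$ is a fixed vertex of one of the polygons $C_x$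 (the same vertex for all $\sigma$). A maximal forest $F$ of $C$ is obtained by deleting one edge from each $C_x$; if the edge deleted from $C_x$ is $e_j$, put $\epsilon(F,x)=(-1)^j$, and let $\epsilon_F=\prod_x\epsilon(F,x)$, $\epsilon_\sigma=\prod_x\mathrm{sign}(\sigma_x)$. The edges of $F$ are ordered by choosing an ordering of the vertices of $\gamma$, listing the edges of the polygons $C_x$ one polygon after another in that order, with the edges of each $C_x$ in the order $e_1,\dots,e_{|x|}$, and omitting the deleted edges (since each $F\cap C_x$ has an even number of edges, the orientation does not depend on the ordering of the vertices). Then $$z(\gamma)=\sum_\sigma\sum_F\epsilon_\sigma\epsilon_F\,(G^\sigma,b,F),$$ the sums being over all collections $\sigma$ and all maximal forests $F$ of $C$. This chain is a cycle. *)

(* Defs.v *)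
(* Library: MathComp. *)
From Stdlib Require List.
From mathcomp Require Import all_boot perm all_algebra.

Set Implicit Arguments.
Unset Strict Implicit.
Unset Printing Implicit Defensive.

Import GRing.Theory.
Local Open Scope ring_scope.

(* Half-edge graphs: [inc h] is the vertex at which [h] is attached and
   [opp h] is the other half of the edge containing [h]. *)
Record graph := Graph {
  vert : finType;
  half : finType;
  inc : half -> vert;
  opp : half -> half;
  oppK : involutive opp;
  opp_neq : forall h, opp h != h }.

Definition edge (G : graph) (h : half G) : {set half G} := [set h; opp h].

Definition edges (G : graph) : {set {set half G}} := [set edge h | h : half G].

Definition valence (G : graph) (x : vert G) : nat :=
  #|[set h : half G | inc h == x]|.

Definition adj (G : graph) : rel (vert G) :=
  fun x y => [exists h : half G, (inc h == x) && (inc (opp h) == y)].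

Definition connected (G : graph) : Prop :=
  (0 < #|vert G|)%N /\ forall x y : vert G, connect (@adj G) x y.

(* |E| - |V| + number of components; the truncated subtraction is exact. *)
Definition betti1 (G : graph) : nat :=
  (#|edges G| + n_comp (@adj G) (vert G) - #|vert G|)%N.

(* A cycle, given by its half-edges in the direction of travel. Loops and
   pairs of parallel edges are cycles of length 1 and 2. *)
Definition simple_cycle (G : graph) (c : seq (half G)) : Prop :=
  [/\ c != [::],
      cycle (fun h h' => inc (opp h) == inc h') c,
      uniq [seq inc h | h <- c] &
      uniq [seq edge h | h <- c]].

Definition is_forest (G : graph) (F : seq {set half G}) : Prop :=
  [/\ uniq F, {subset F <= edges G} &
      ~ exists2 c, simple_cycle c & {in c, forall h, edge h \in F}].

(* The edges of F are listed in an order representing the orientation. *)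
Record triple := Triple {
  tgraph : graph;
  tbase : vert tgraph;
  tforest : seq {set half tgraph} }.

(* The conditions on the triples that generate C_k(Aut(F_n)). *)
Definition generator (n k : nat) (T : triple) : Prop :=
  [/\ connected (tgraph T), betti1 (tgraph T) = n,
      (forall x : vert (tgraph T),
         (if x == tbase T then 2 else 3) <= valence x)%N,
      is_forest (tforest T) & size (tforest T) = k].

Definition reorder (A : Type) (s : seq A) (p : 'S_(size s)) : seq A :=
  [seq tnth (in_tuple s) (p i) | i <- enum 'I_(size s)].

Definition triple_iso (T T' : triple) : Prop :=
  exists (f : vert (tgraph T) -> vert (tgraph T'))
         (g : half (tgraph T) -> half (tgraph T')),
    [/\ bijective f, bijective g,
        forall h, inc (g h) = f (inc h) & forall h, opp (g h) = g (opp h)]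
    /\ f (tbase T) = tbase T'
    /\ exists2 p : 'S_(size (tforest T')), ~~ odd_perm p &
         [seq g @: (e : {set _}) | e <- tforest T] = reorder p.

(* [T'] is [T] with the opposite orientation. With fewer than two forest
   edges there is no odd reordering, hence no relation. *)
Definition opposite (T T' : triple) : Prop :=
  exists2 p : 'S_(size (tforest T)), odd_perm p &
    T' = Triple (tbase T) (reorder p).

(* Finite formal rational linear combinations of oriented triples, with
   concatenation as addition. (The type of all triples is too large to carry
   the choice structure needed for the free modules of the libraries.) *)
Definition chain := seq (rat * triple).

Definition scale (a : rat) (c : chain) : chain :=
  [seq (a * t.1, t.2) | t <- c].

(* Equality in the Q-vector space spanned by isomorphism classes of oriented
   triples modulo (G, b, F) + (G, b, -F) = 0. The constructors before
   [chain_eq_iso] define the free Q-vector space on all triples. *)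
Inductive chain_eq : chain -> chain -> Prop :=
| chain_eq_refl c : chain_eq c c
| chain_eq_sym c d : chain_eq c d -> chain_eq d c
| chain_eq_trans c d e : chain_eq c d -> chain_eq d e -> chain_eq c e
| chain_eq_cat c c' d d' :
    chain_eq c c' -> chain_eq d d' -> chain_eq (c ++ d) (c' ++ d')
| chain_eq_catC c d : chain_eq (c ++ d) (d ++ c)
| chain_eq_add a a' T : chain_eq [:: (a, T); (a', T)] [:: (a + a', T)]
| chain_eq_zero T : chain_eq [:: (0, T)] [::]
| chain_eq_iso a T T' : triple_iso T T' -> chain_eq [:: (a, T)] [:: (a, T')]
| chain_eq_opp a T T' : opposite T T' -> chain_eq [:: (a, T); (a, T')] [::].

(* C_k(Aut(F_n)) consists of the classes under [chain_eq] of the chains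
   satisfying this predicate. As [generator n k] is invariant under
   isomorphism and reordering, [chain_eq] induces on these chains the relation
   obtained by using only triples that satisfy [generator n k]. *)
Definition is_chain (n k : nat) (c : chain) : Prop :=
  List.Forall (fun t => generator n k t.2) c.

Section Contraction.
Variables (G : graph) (e : {set half G}).

Definition ends : {set vert G} := [set inc h | h in e].

Definition collapse (x : vert G) : {set vert G} :=
  if x \in ends then ends else [set x].

(* Vertices of G_e: the classes of the vertices of G under the relation
   identifying the ends of [e]. *)
Definition cvert := {A : {set vert G} | A \in codom collapse}.

(* For an edge [e] the second condition follows from the first. *)
Definition chalf := {h : half G | (h \notin e) && (opp h \notin e)}.

Definition cinc (h : chalf) : cvert :=
  exist _ (collapse (inc (val h))) (codom_f collapse (inc (val h))).

Lemma copp_subproof (h : chalf) :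
  (opp (val h) \notin e) && (opp (opp (val h)) \notin e).
Proof. by case: h => h /= /andP[h1 h2]; rewrite oppK h1 h2. Qed.

Definition copp (h : chalf) : chalf := exist _ (opp (val h)) (copp_subproof h).

Lemma coppK : involutive copp.
Proof. by move=> h; apply: val_inj; rewrite /= oppK. Qed.

Lemma copp_neq h : copp h != h.
Proof. by rewrite -val_eqE /= opp_neq. Qed.

Definition contract : graph := @Graph cvert chalf cinc copp coppK copp_neq.

Definition contract_vert (x : vert G) : vert contract :=
  exist _ (collapse x) (codom_f collapse x).

Definition contract_edge (e' : {set half G}) : {set half contract} :=
  [set h : chalf | val h \in e'].

End Contraction.

Definition remove_nth (A : Type) (i : nat) (s : seq A) : seq A :=
  take i s ++ drop i.+1 s.

(* The forest edges are numbered from 1 in the formula for the boundary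
   and from 0 here. *)
Definition bd_triple (T : triple) : chain :=
  flatten [seq
    let e := nth set0 (tforest T) i in
    let F := remove_nth i (tforest T) in
    scale ((-1) ^+ i.+1)
      [:: (1, Triple (tbase T) F);
          (-1, Triple (contract_vert e (tbase T))
                      [seq contract_edge e e' | e' <- F])]
    | i <- iota 0 (size (tforest T))].

Definition bd (c : chain) : chain :=
  flatten [seq scale t.1 (bd_triple t.2) | t <- c].

(* [c] is a boundary in the complex C_*(Aut(F_n)), in degree [k]. *)
Definition is_boundary (n k : nat) (c : chain) : Prop :=
  is_chain n k c /\ exists2 d, is_chain n k.+1 d & chain_eq (bd d) c.

Section AddLoop.
Variables (G : graph) (b : vert G).

Definition linc (h : half G + bool) : vert G :=
  match h with inl h => inc h | inr _ => b end.

Definition lopp (h : half G + bool) : half G + bool :=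
  match h with inl h => inl (opp h) | inr c => inr (~~ c) end.

Lemma loppK : involutive lopp.
Proof. by case=> [h|c] /=; rewrite ?oppK ?negbK. Qed.

Lemma lopp_neq h : lopp h != h.
Proof. by case: h => [h|[]] //; apply: contraNneq (opp_neq h) => -[->]. Qed.

Definition add_loop : graph :=
  @Graph (vert G) (half G + bool)%type linc lopp loppK lopp_neq.

End AddLoop.

Definition stab_triple (T : triple) : triple :=
  @Triple (add_loop (tbase T)) (tbase T)
    [seq [set (inl h : half (add_loop (tbase T))) | h in (e : {set _})]
       | e <- tforest T].

Definition stab (c : chain) : chain :=
  [seq (t.1, stab_triple t.2) | t <- c].

Definition admissible (g : graph) : Prop :=
  connected g /\ forall x : vert g, odd (valence x) && (3 <= valence x)%N.

(* An ordering of the half-edges at every vertex, representing a vertex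
   orientation: [pos h] is the position of [h] among the half-edges at
   [inc h]. Positions, and the vertices and edges of the polygons below,
   are numbered from 0 instead of 1. *)
Record vertex_ordering (g : graph) := VertexOrdering {
  pos : forall h : half g, 'I_(valence (inc h));
  pos_inj : forall h h' : half g,
    inc h = inc h' -> pos h = pos h' :> nat -> h = h' }.

(* [Tagged _ i] with tag [x] stands both for the vertex v_i and for the edge
   e_i of the polygon C_x; e_i joins v_(i-1) to v_i. *)
Definition corner (g : graph) := {x : vert g & 'I_(valence x)}.

Definition corner_pred (g : graph) (v : corner g) : corner g :=
  Tagged (fun x => 'I_(valence x)) (ord_pred (tagged v)).

Definition permutations_at (g : graph) :=
  {dffun forall x : vert g, 'S_(valence x)}.

Definition deletions (g : graph) := {dffun forall x : vert g, 'I_(valence x)}.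

Section Cycle.
Variables (g : graph) (o : vertex_ordering g).

Section PolygonGraph.
Variable s : permutations_at g.

(* The two halves of the polygon edge [v] are [inr (v, false)], at its
   initial vertex, and [inr (v, true)], at its final vertex. *)
Definition phalf := (half g + corner g * bool)%type.

Definition pinc (h : phalf) : corner g :=
  match h with
  | inl h => Tagged (fun x => 'I_(valence x)) (s (inc h) (pos o h))
  | inr (v, c) => if c then v else corner_pred v
  end.

Definition popp (h : phalf) : phalf :=
  match h with inl h => inl (opp h) | inr (v, c) => inr (v, ~~ c) end.

Lemma poppK : involutive popp.
Proof. by case=> [h|[v c]] /=; rewrite ?oppK ?negbK. Qed.

Lemma popp_neq h : popp h != h.
Proof.
case: h => [h|[v []]] /=; last 2 first.
- by apply/eqP => -[].
- by apply/eqP => -[].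
by apply: contraNneq (opp_neq h) => -[->].
Qed.

Definition polygon_graph : graph :=
  @Graph (corner g) phalf pinc popp poppK popp_neq.

Definition polygon_edge (v : corner g) : {set half polygon_graph} :=
  @edge polygon_graph (inr (v, false)).

(* The deleted edge of C_x is [d x]. *)
Definition maximal_forest (d : deletions g) : seq {set half polygon_graph} :=
  [seq polygon_edge v |
     v : corner g <- [seq Tagged (fun x => 'I_(valence x)) i
                        | x <- enum (vert g), i <- enum 'I_(valence x)]
     & tagged v != d (tag v)].

End PolygonGraph.

Definition sign_perms (s : permutations_at g) : rat :=
  \prod_(x : vert g) (-1) ^+ odd_perm (s x).

Definition sign_forest (d : deletions g) : rat :=
  \prod_(x : vert g) (-1) ^+ (d x).+1.

Definition zcycle (b : corner g) : chain :=
  [seq (sign_perms s * sign_forest d,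
        @Triple (polygon_graph s) b (maximal_forest s d))
     | s <- enum {: permutations_at g}, d <- enum {: deletions g}].

End Cycle.

(* Main.v *)
(* Let k = |x| for the polygon carrying b. Homotopically, the half-edges at x
   wander around this k-gon, and one of them may also travel once along the
   added loop. Sliding one end of the loop around the polygon changes the latter
   family by the former one, so z becomes a boundary.

   Combinatorially, consider two families of graphs, both antisymmetrized over
   the k + 1 objects formed by the half-edges at x and one end of the loop:
   X, where these objects sit on a (k+1)-gon whose extra vertex is the basepoint
   and carries the other end of the loop; and Z, where a half-edge at x sits in
   the middle of the loop, the loop being attached to the k-gon at the basepoint
   and at the place of the last object. Contracting a polygon edge identifies the
   graphs of two arrangements differing by a transposition, so these terms of
   the boundary cancel. When the members of X are weighted by the position of
   the end of the loop, what remains are the graphs in which this end meets a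
   half-edge; those away from the basepoint cancel against the contractions of
   the loop edges of Z, and those at the basepoint give (k - 1) s(z) up to
   sign. *)

From mathcomp Require Import all_boot all_algebra.
From mathcomp Require Import fingroup perm zify ring lra.
From Stdlib Require Import ClassicalEpsilon Classical.
Require Import Defs.

Set Implicit Arguments.
Unset Strict Implicit.
Unset Printing Implicit Defensive.

Import GRing.Theory Num.Theory.
Local Open Scope ring_scope.

(** * Invariant functionals on chains *)

(** The coefficient [k - 1] is forced by the weight. With a constant weight every contraction in X
    would cancel. The inner edges must each carry the jump -1 to match Z, and jumps around a closed
    polygon add up to zero; so the [k - 1] inner edges leave a jump of [k - 1] for the edge between
    [b] and the basepoint.

    Z enters twice, with opposite signs: its forest contains either one half of the subdivided loop
    or the other. In a single copy the terms where that half is removed from the forest would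
    survive, but this removal leaves the same forest in both copies, so the difference kills them.
    The contractions of the half at the basepoint then cancel in pairs, except when both halves join
    the basepoint to the middle of the loop. A symmetry exchanges the halves there, which takes away
    exactly the terms whose loop end is at [b]; those left match the inner edges of X.

    Odd valence gives each polygon an even number of forest edges, and this controls the signs in
    the comparison with z. *)

Definition eval (phi : triple -> rat) (c : chain) : rat :=
  \sum_(t <- c) t.1 * phi t.2.

Definition invariant (phi : triple -> rat) : Prop :=
  (forall T T', triple_iso T T' -> phi T = phi T') /\
  (forall T T', opposite T T' -> phi T' = - phi T).

Lemma eval_cat phi c d : eval phi (c ++ d) = eval phi c + eval phi d.
Proof. exact: big_cat. Qed.

Lemma eval_scale phi a c : eval phi (scale a c) = a * eval phi c.
Proof.
by rewrite /eval big_map mulr_sumr; apply: eq_bigr => t _; rewrite mulrA.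
Qed.

Lemma eval_flatten phi (I : Type) (r : seq I) (F : I -> chain) :
  eval phi (flatten [seq F i | i <- r]) = \sum_(i <- r) eval phi (F i).
Proof.
elim: r => [|i r IHr] /=; first by rewrite /eval !big_nil.
by rewrite eval_cat IHr big_cons.
Qed.

Lemma chain_eq_eval phi c d :
  invariant phi -> chain_eq c d -> eval phi c = eval phi d.
Proof.
case=> phi_iso phi_opp; elim=> {c d}.
- by [].
- by move=> c d _ ->.
- by move=> c d e _ -> _ ->.
- by move=> c c' d d' _ e1 _ e2; rewrite !eval_cat e1 e2.
- by move=> c d; rewrite !eval_cat addrC.
- by move=> a a' T; rewrite /eval !big_cons !big_nil /= !addr0 mulrDl.
- by move=> T; rewrite /eval big_cons !big_nil /= mul0r addr0.
- by move=> a T T' /phi_iso eT; rewrite /eval !big_cons !big_nil /= eT.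
- move=> a T T' /phi_opp eT; rewrite /eval !big_cons !big_nil /= eT.
  by rewrite mulrN addr0 subrr.
Qed.

(** Equality up to the sign given by [e] in the quotient, required for every coefficient because
    [chain_eq] has no constructor for scaling. *)
Definition similar (e : bool) (T T' : triple) : Prop :=
  forall a, chain_eq [:: (a, T)] [:: ((-1) ^+ e * a, T')].

Lemma similar_refl T : similar false T T.
Proof. by move=> a; rewrite mul1r; apply: chain_eq_refl. Qed.

Lemma similar_trans e e' T T' T'' :
  similar e T T' -> similar e' T' T'' -> similar (e (+) e') T T''.
Proof.
move=> s1 s2 a; apply: chain_eq_trans (s1 a) _.
by rewrite addbC signr_addb -mulrA; apply: s2.
Qed.

Lemma similar_sym e T T' : similar e T T' -> similar e T' T.
Proof.
move=> s a; apply: chain_eq_sym.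
by have := s ((-1) ^+ e * a); rewrite signrMK.
Qed.

Lemma similar_iso T T' : triple_iso T T' -> similar false T T'.
Proof. by move=> eT a; rewrite mul1r; apply: chain_eq_iso. Qed.

Lemma similar_opposite T T' : opposite T T' -> similar true T T'.
Proof.
move=> oT a; rewrite mulN1r.
apply: (@chain_eq_trans _ ([:: (a, T)] ++ [:: (a, T'); (- a, T')])).
  apply: (chain_eq_cat (chain_eq_refl [:: (a, T)])).
  apply: chain_eq_sym; apply: chain_eq_trans (chain_eq_add _ _ _) _.
  by rewrite subrr; apply: chain_eq_zero.
exact: (chain_eq_cat (chain_eq_opp a oT) (chain_eq_refl [:: (- a, T')])).
Qed.

Definition decide (P : Prop) : bool := excluded_middle_informative P.

Lemma decideP P : reflect P (decide P).
Proof. by rewrite /decide; case: excluded_middle_informative; constructor. Qed.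

(** The coefficient of the class of [T]. If [T] is similar to its own opposite, the two indicators
    coincide and the functional vanishes, as it must on a quotient where that class is zero. *)
Definition coordinate (T T' : triple) : rat :=
  (decide (similar false T T'))%:R - (decide (similar true T T'))%:R.

Lemma coordinate_invariant T : invariant (coordinate T).
Proof.
have decide_congr (P Q : Prop) : (P <-> Q) -> decide P = decide Q.
  by move=> PQ; apply/decideP/decideP; apply PQ.
split=> U U' sU; rewrite /coordinate.
  have sU' := similar_iso sU.
  have eqd e : decide (similar e T U) = decide (similar e T U').
    apply: decide_congr; split=> s; rewrite -[e]addbF.
      exact: similar_trans s sU'.
    exact: similar_trans s (similar_sym sU').
  by rewrite !eqd.
have sU' := similar_opposite sU.
have eqd e : decide (similar e T U) = decide (similar (~~ e) T U').
  apply: decide_congr; split=> s; rewrite -?[~~ e]addbT; first exact: similar_trans s sU'.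
  rewrite -[e]negbK -addbT; exact: similar_trans s (similar_sym sU').
by rewrite !eqd opprB.
Qed.

(** After collecting the multiples of [T], the functional [coordinate T] vanishes on the remainder
    [d]; the bound on its size drives the induction in [chain_eq0P]. *)
Lemma chain_eq_gather T (c : chain) : exists a (d : chain),
  [/\ (size d <= size c)%N, chain_eq c ((a, T) :: d) &
      List.Forall (fun t => forall e, ~ similar e T t.2) d].
Proof.
elim: c => [|[a U] c [a' [d [sz_d eq_d d_dis]]]].
  exists 0, [::]; split=> //; apply: chain_eq_sym.
  exact: chain_eq_zero.
have eq_c := chain_eq_cat (chain_eq_refl [:: (a, U)]) eq_d.
case: (classic (exists e, similar e T U)) => [[e sU] | dis].
  exists ((-1) ^+ e * a + a'), d; split=> //; first exact: leqW.
  apply: chain_eq_trans eq_c _.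
  apply: (chain_eq_cat (c := [:: (a, U); (a', T)])
            (c' := [:: (_, T)]) _ (chain_eq_refl d)).
  apply: chain_eq_trans (chain_eq_add _ _ _).
  exact: (chain_eq_cat (similar_sym sU a) (chain_eq_refl [:: (a', T)])).
exists a', ((a, U) :: d); split=> //; last first.
  by constructor=> // e sU; apply: dis; exists e.
apply: chain_eq_trans eq_c _.
exact: (chain_eq_cat (chain_eq_catC [:: (a, U)] [:: (a', T)])
          (chain_eq_refl d)).
Qed.

(** The gathered coefficient of the first triple is read off by [coordinate] and hence zero, unless
    the triple equals its own opposite, when the term is zero in any case. A shorter chain
    remains. *)
Lemma chain_eq0P c :
  (forall phi, invariant phi -> eval phi c = 0) -> chain_eq c [::].
Proof.
elim: {c}(size c) {-2}c (leqnn (size c)) => [|m IHm] [|[a T] c] //= sz_c c0;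
  try exact: chain_eq_refl.
have [a' [d [sz_d eq_d d_dis]]] := chain_eq_gather T c.
have eq_c : chain_eq ((a, T) :: c) ((a + a', T) :: d).
  apply: chain_eq_trans (chain_eq_cat (chain_eq_refl [:: (a, T)]) eq_d) _.
  exact: (chain_eq_cat (chain_eq_add a a' T) (chain_eq_refl d)).
have eq0 : chain_eq [:: (a + a', T)] [::].
  have e1 : decide (similar false T T) by apply/decideP; apply: similar_refl.
  have := c0 _ (coordinate_invariant T).
  rewrite (chain_eq_eval (coordinate_invariant T) eq_c) /eval big_cons /=.
  have -> : \sum_(t <- d) t.1 * coordinate T t.2 = 0.
    elim: d_dis => [|[x U] d' dU _ IHd]; rewrite ?big_nil // big_cons IHd addr0.
    have ndU e : decide (similar e T U) = false by apply/decideP/dU.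
    by rewrite /coordinate !ndU subrr mulr0.
  rewrite addr0.
  rewrite {1}/coordinate e1; case: (decideP (similar true T T)) => [sT _|_].
    (* Here [T] equals its opposite: one half of the term is turned into the negative of the other
       half. *)
    set h := (a + a') / 2%:R; have -> : a + a' = h + h by rewrite /h; field.
    apply: chain_eq_trans (chain_eq_sym (chain_eq_add h h T)) _.
    apply: chain_eq_trans
      (chain_eq_cat (sT h) (chain_eq_refl [:: (h, T)])) _.
    apply: chain_eq_trans (chain_eq_add _ _ _) _.
    by rewrite mulN1r addNr; apply: chain_eq_zero.
  by rewrite subr0 mulr1 => ->; apply: chain_eq_zero.
have eq_cd : chain_eq ((a, T) :: c) d.
  exact: chain_eq_trans eq_c (chain_eq_cat eq0 (chain_eq_refl d)).
apply: (chain_eq_trans eq_cd); apply: IHm; first exact: leq_trans sz_d _.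
by move=> phi phi_inv; rewrite -(chain_eq_eval phi_inv eq_cd) c0.
Qed.

(* Invariant functionals separate chains, which reduces identities between
   chains to identities between sums of rational numbers. *)
Lemma chain_eqP c d :
  (forall phi, invariant phi -> eval phi c = eval phi d) -> chain_eq c d.
Proof.
move=> eq_cd; have cd0 : chain_eq (c ++ scale (-1) d) [::].
  apply: chain_eq0P => phi /eq_cd.
  by rewrite eval_cat eval_scale mulN1r => ->; rewrite subrr.
have dd0 : chain_eq (scale (-1) d ++ d) [::].
  apply: chain_eq0P => phi _.
  by rewrite eval_cat eval_scale mulN1r addNr.
have e1 := chain_eq_cat cd0 (chain_eq_refl d).
have e2 := chain_eq_cat (chain_eq_refl c) dd0.
rewrite catA cats0 in e2; exact: chain_eq_trans (chain_eq_sym e2) e1.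
Qed.

(** * Reorderings of the forest and the boundary of a triple *)

Lemma reorder1 (A : Type) (s : seq A) : reorder (1%g : 'S_(size s)) = s.
Proof.
case: s => [|x s]; first by rewrite /reorder /= (size0nil (size_enum_ord 0)).
apply: (@eq_from_nth _ x) => [|i]; rewrite size_map size_enum_ord // => lt_i.
rewrite (nth_map (Ordinal lt_i)) ?size_enum_ord // perm1 (tnth_nth x) /=.
by rewrite nth_enum_ord.
Qed.

Lemma reorder_tperm (A : Type) (s1 s2 : seq A) (x y : A)
    (i j : 'I_(size (s1 ++ x :: y :: s2))) :
  i = size s1 :> nat -> j = (size s1).+1 :> nat ->
  reorder (tperm i j) = s1 ++ y :: x :: s2.
Proof.
move=> ei ej; apply: (@eq_from_nth _ x) => [|m].
  by rewrite size_map size_enum_ord !size_cat.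
rewrite size_map size_enum_ord => lt_m.
rewrite (nth_map i) ?size_enum_ord // (tnth_nth x) /=.
have ltnS_false : ((size s1).+1 < size s1)%N = false by lia.
set m' := nth i _ _; have em : m' = m :> nat by rewrite nth_enum_ord.
case: tpermP => [e|e|/eqP ni /eqP nj].
- move: em; rewrite e ej ei => <-.
  by rewrite !nth_cat ltnS_false ltnn subnn subSnn.
- move: em; rewrite e ej ei => <-.
  by rewrite !nth_cat ltnS_false ltnn subnn subSnn.
have {}ni : m != size s1 by rewrite -em -ei -val_eqE in ni *.
have {}nj : m != (size s1).+1 by rewrite -em -ej -val_eqE in nj *.
rewrite em !nth_cat; case: ltnP => // le_m.
case e : (m - size s1)%N => [|[|q]] //; exfalso; lia.
Qed.

Lemma triple_iso_map (G G' : graph) (b : vert G) (b' : vert G') F F'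
    (f : vert G -> vert G') (g : half G -> half G') :
  bijective f -> bijective g -> (forall h, inc (g h) = f (inc h)) ->
  (forall h, opp (g h) = g (opp h)) -> f b = b' ->
  F' = [seq g @: (e : {set _}) | e <- F] ->
  triple_iso (Triple b F) (Triple b' F').
Proof.
move=> bf bg f_inc g_opp fb eF; exists f, g; split=> //; split=> //.
by exists 1%g; rewrite ?odd_perm1 // reorder1.
Qed.

Section InvariantTheory.
Variables (phi : triple -> rat) (phi_inv : invariant phi).

Lemma invariant_swap (G : graph) (b : vert G) F1 F2 e e' :
  phi (Triple b (F1 ++ e :: e' :: F2)) = - phi (Triple b (F1 ++ e' :: e :: F2)).
Proof.
have lt1 : (size F1 < size (F1 ++ e' :: e :: F2))%N by rewrite size_cat /=; lia.
have lt2 : ((size F1).+1 < size (F1 ++ e' :: e :: F2))%N.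
  by rewrite size_cat /=; lia.
apply: (proj2 phi_inv); exists (tperm (Ordinal lt1) (Ordinal lt2)).
  by rewrite odd_tperm -val_eqE /= neq_ltn leqnn.
by rewrite /= reorder_tperm.
Qed.

Lemma invariant_rot (G : graph) (b : vert G) F1 F2 F3 F4 :
  phi (Triple b (F1 ++ F2 ++ F3 ++ F4)) =
  (-1) ^+ (size F2 * size F3) * phi (Triple b (F1 ++ F3 ++ F2 ++ F4)).
Proof.
elim: F2 F1 => [|e F2 IHF] F1 /=; first by rewrite mul1r.
have {}IHF := IHF (rcons F1 e); rewrite !cat_rcons in IHF.
rewrite IHF mulSn addnC exprD -mulrA; congr (_ * _).
elim: F3 F1 {IHF} => [|e' F3 IHF] F1 /=; first by rewrite mul1r.
rewrite invariant_swap -cat_rcons IHF exprS mulN1r mulNr cat_rcons.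
by [].
Qed.

(** Labelling the forest by a duplicate-free list turns the removal of an edge into filtering out
    its label. One sign is absorbed by putting the contraction first in the difference. *)
Lemma eval_bd_triple (G : graph) (b : vert G) (U : eqType)
    (f : U -> {set half G}) (M : seq U) : uniq M ->
  eval phi (bd_triple (Triple b [seq f u | u <- M])) =
  \sum_(u <- M) (-1) ^+ index u M *
    (phi (Triple (contract_vert (f u) b)
       [seq contract_edge (f u) (f v) | v <- M & v != u]) -
     phi (Triple b [seq f v | v <- M & v != u])).
Proof.
move=> M_uniq; rewrite eval_flatten /= size_map.
case: M M_uniq => [|u0 M0]; first by rewrite !big_nil.
move: (u0 :: M0) => M M_uniq.
rewrite (big_nth u0) /index_iota subn0; apply: eq_big_seq => i.
rewrite mem_iota add0n => /= lt_i.
rewrite /eval !big_cons big_nil /= addr0 index_uniq //.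
rewrite mulr1 mulrN1 mulNr -mulrBr exprS mulN1r mulNr -mulrN opprB.
congr (_ * _).
rewrite (nth_map u0) //.
have -> : remove_nth i [seq f u | u <- M] =
    [seq f v | v <- M & v != nth u0 M i].
  rewrite /remove_nth -map_take -map_drop -map_cat; congr (map _ _).
  rewrite -rem_filter // remE index_uniq //.
by rewrite -map_comp.
Qed.

End InvariantTheory.

(** * Graphs and contractions *)

Lemma surjective_injective_bij (A B : finType) (f : A -> B) :
  injective f -> (forall y, exists x, f x = y) -> bijective f.
Proof.
move=> f_inj f_surj; apply: inj_card_bij => //.
rewrite -(card_codom f_inj); apply/subset_leq_card/subsetP => y _.
by have [x <-] := f_surj y; apply: codom_f.
Qed.

Lemma edge_opp (G : graph) (h : half G) : edge (opp h) = edge h.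
Proof. by rewrite /edge oppK setUC. Qed.

Lemma mem_edge (G : graph) (h h' : half G) :
  (h' \in edge h) = (h' == h) || (h' == opp h).
Proof. by rewrite !inE. Qed.

Lemma edge_eqP (G : graph) (h h' : half G) :
  reflect (h = h' \/ h = opp h') (edge h == edge h').
Proof.
apply: (iffP eqP) => [e|[->|->]]; rewrite ?edge_opp //.
have : h \in edge h' by rewrite -e mem_edge eqxx.
by rewrite mem_edge => /orP[]/eqP->; [left|right].
Qed.

Lemma ends_edge (G : graph) (h : half G) :
  ends (edge h) = [set inc h; inc (opp h)].
Proof. by rewrite /ends /edge imsetU1 imset_set1. Qed.

Lemma collapse_eqP (G : graph) (e : {set half G}) (x y : vert G) :
  reflect (x = y \/ x \in ends e /\ y \in ends e) (collapse e x == collapse e y).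
Proof.
rewrite /collapse; apply: (iffP eqP) => [|[->|[-> ->]]] //.
case: ifP => ex; case: ifP => ey // E; try by [right | left; apply: set1_inj].
  by move: ey; rewrite E set11.
by move: ex; rewrite -E set11.
Qed.

(** The maps need not form an isomorphism before the contraction: incidences have to agree only once
    the ends of the contracted edge are merged. This is what identifies arrangements that differ by
    a transposition of these ends. *)
Lemma triple_iso_contract (G G' : graph) (e : {set half G}) (e' : {set half G'})
    (b : vert G) (b' : vert G') (U : Type) (M : seq U)
    (F : U -> {set half G}) (F' : U -> {set half G'})
    (f : vert G -> vert G') (g : half G -> half G') :
  injective f -> (forall y, exists x, f x = y) ->
  injective g -> (forall y, exists x, g x = y) ->
  (forall h, opp (g h) = g (opp h)) ->
  e' = g @: e -> ends e' = f @: ends e ->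
  (forall h, h \notin e -> collapse e' (inc (g h)) = collapse e' (f (inc h))) ->
  collapse e' (f b) = collapse e' b' ->
  (forall u, F' u = g @: F u) ->
  triple_iso (Triple (contract_vert e b) [seq contract_edge e (F u) | u <- M])
    (Triple (contract_vert e' b') [seq contract_edge e' (F' u) | u <- M]).
Proof.
move=> f_inj f_surj g_inj g_surj g_opp -> ends_f inc_g eb eF.
set E := g @: e in ends_f inc_g eb *.
have fE x : (f x \in ends E) = (x \in ends e) by rewrite ends_f mem_imset.
have gE h : (g h \in E) = (h \in e) by rewrite /E mem_imset.
have collE x : collapse E (f x) = f @: collapse e x.
  by rewrite /collapse fE; case: ifP => _ //; rewrite imset_set1.
have ff_sub (A : cvert e) : f @: val A \in codom (collapse E).
  by case: A => A /= /codomP[x ->]; rewrite -collE codom_f.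
pose ff (A : vert (contract e)) : vert (contract E) := exist _ (f @: val A) (ff_sub A).
have gg_sub (h : chalf e) : (g (val h) \notin E) && (opp (g (val h)) \notin E).
  by case: h => h /= /andP[h1 h2]; rewrite g_opp !gE h1.
pose gg (h : half (contract e)) : half (contract E) := exist _ (g (val h)) (gg_sub h).
have gg_inj : injective gg by move=> h h' /(congr1 val) /= /g_inj /val_inj.
apply: (@triple_iso_map _ _ _ _ _ _ ff gg) => /=.
- apply: surjective_injective_bij => [A B /(congr1 val) /= /imset_inj E1|].
    exact/val_inj/E1.
  case=> A /= A_im; have /codomP[y eA] := A_im; have [x ex] := f_surj y.
  exists (exist _ (collapse e x) (codom_f _ x)); apply: val_inj => /=.
  by rewrite -collE ex.
- apply: surjective_injective_bij => //.
  case=> y /= y_nE; have [x ex] := g_surj y.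
  have x_ne : (x \notin e) && (opp x \notin e).
    by rewrite -!gE -g_opp ex.
  by exists (exist _ x x_ne); apply: val_inj.
- by move=> h; apply: val_inj; rewrite /= inc_g ?collE //; case/andP: (valP h).
- by move=> h; apply: val_inj; rewrite /= g_opp.
- by apply: val_inj; rewrite /= -collE.
rewrite -map_comp; apply: eq_map => u /=; apply/setP=> h'.
rewrite inE eF; apply/imsetP/imsetP => [[h h_u eh]|[h h_u ->]].
  case: h' eh => h' h'_nE /= eh.
  have h_ne : (h \notin e) && (opp h \notin e) by rewrite -!gE -g_opp -eh.
  by exists (exist _ h h_ne); rewrite ?inE //; apply: val_inj.
by exists (val h) => //; rewrite inE in h_u.
Qed.

(** Here [f] picks a representative of each vertex of the contraction, so that a smaller graph can
    be compared directly with a contracted larger one. *)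
Lemma triple_iso_contract_section (G G' : graph) (e : {set half G})
    (b : vert G) (b' : vert G') (U : Type) (M : seq U)
    (F : U -> {set half G}) (F' : U -> {set half G'})
    (f : vert G' -> vert G) (g : half G' -> half G) :
  (forall x y, collapse e (f x) = collapse e (f y) -> x = y) ->
  (forall y, exists x, collapse e (f x) = collapse e y) ->
  injective g -> (forall h, g h \notin e) ->
  (forall h, h \notin e -> exists h', g h' = h) ->
  (forall h, opp (g h) = g (opp h)) ->
  (forall h, collapse e (inc (g h)) = collapse e (f (inc h))) ->
  collapse e (f b') = collapse e b ->
  (forall u, F u = g @: F' u) ->
  triple_iso (Triple b' [seq F' u | u <- M])
    (Triple (contract_vert e b) [seq contract_edge e (F u) | u <- M]).
Proof.
move=> f_inj f_surj g_inj g_ne g_surj g_opp inc_g fb eF.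
have gg_sub h : (g h \notin e) && (opp (g h) \notin e).
  by rewrite g_opp !g_ne.
pose gg h : half (contract e) := exist _ (g h) (gg_sub h).
apply: (@triple_iso_map _ _ _ _ _ _ (fun x => contract_vert e (f x)) gg) => /=.
- apply: surjective_injective_bij => [x y /(congr1 val) /= /f_inj //|].
  case=> A /= A_im; have /codomP[y eA] := A_im; have [x ex] := f_surj y.
  by exists x; apply: val_inj; rewrite /= ex eA.
- apply: surjective_injective_bij => [x y /(congr1 val) /= /g_inj //|].
  case=> h /= h_ne; have [|h' eh] := g_surj h; first by case/andP: h_ne.
  by exists h'; apply: val_inj.
- by move=> h; apply: val_inj; rewrite /= inc_g.
- by move=> h; apply: val_inj; rewrite /= g_opp.
- by apply: val_inj.
rewrite -map_comp; apply: eq_map => u /=; apply/setP=> h.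
rewrite inE eF; apply/imsetP/imsetP => -[h' h'_u eh]; exists h' => //.
  exact: val_inj.
by rewrite eh.
Qed.

Lemma simple_cycle_rot (G : graph) (c : seq (half G)) m :
  simple_cycle c -> simple_cycle (rot m c).
Proof.
case=> c0 c1 c2 c3; split; rewrite ?rot_cycle ?map_rot ?rot_uniq //.
by rewrite -size_eq0 size_rot size_eq0.
Qed.

(** At a vertex of maximal rank on a cycle both cycle edges would go down, hence coincide, whereas
    the edges of a cycle are distinct. *)
Lemma is_forest_rank (G : graph) (F : seq {set half G}) (rank : vert G -> nat) :
  uniq F -> {subset F <= edges G} ->
  (forall h, edge h \in F -> rank (inc h) != rank (inc (opp h))) ->
  (forall h h', edge h \in F -> edge h' \in F -> inc h = inc h' ->
     (rank (inc (opp h)) < rank (inc h))%N ->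
     (rank (inc (opp h')) < rank (inc h'))%N -> edge h = edge h') ->
  is_forest F.
Proof.
move=> F_uniq F_sub rank_neq F_parent; split=> // -[c c_simple c_F].
have [h0 h0c] : exists h0, h0 \in c.
  by case: c c_simple {c_F} => [[]//|h0 c _]; exists h0; rewrite mem_head.
have [h hc h_max] :
    exists2 h, h \in c & forall h', h' \in c -> (rank (inc h') <= rank (inc h))%N.
  by exists [arg max_(h > h0 in c) rank (inc h)]; case: arg_maxnP.
have h_next : (rank (inc (opp h)) <= rank (inc h))%N.
  case: c_simple => _ c_cyc _ _; rewrite (eqP (next_cycle c_cyc hc)).
  by apply: h_max; rewrite mem_next.
have hF : edge h \in F by apply: c_F.
have /rot_to[m c' ec] := hc.
have := simple_cycle_rot m c_simple; rewrite ec => -[_ /= c_path _].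
move=> /andP[h_notin _].
have memc h' : (h' \in h :: c') = (h' \in c) by rewrite -ec mem_rot.
(* A cycle of length one is a loop, excluded by the ranks of its ends. Otherwise the last half-edge
   [h'] enters the top vertex that [h] leaves. *)
case/lastP: c' ec c_path h_notin memc => [|c' h'] ec /=.
  rewrite andbT => /eqP e _ _.
  by move: (rank_neq _ hF); rewrite e eqxx.
rewrite rcons_path last_rcons => /andP[_ /eqP e] h_notin memc.
have h'c : h' \in c by rewrite -memc inE mem_rcons mem_head orbT.
have h'F : edge h' \in F by apply: c_F.
case/negP: h_notin; apply/mapP; exists h'; first by rewrite mem_rcons mem_head.
rewrite -(edge_opp h'); apply: F_parent => //.
- by rewrite edge_opp.
- by rewrite ltn_neqAle eq_sym rank_neq.
by rewrite oppK e ltn_neqAle -e rank_neq // e h_max.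
Qed.

Lemma card_half (G : graph) : #|half G| = (2 * #|edges G|)%N.
Proof.
transitivity (\sum_(h : half G) 1)%N; first by rewrite sum1_card.
rewrite (partition_big (fun h : half G => edge h) (mem (edges G))) /=; last first.
  by move=> h _; apply: imset_f.
rewrite mulnC -sum_nat_const; apply: eq_bigr => e /imsetP[h _ ->].
transitivity #|[set h; opp h]|; last by rewrite cards2 eq_sym opp_neq.
rewrite -sum1_card; apply: eq_bigl => h' /=.
by rewrite !inE; apply/edge_eqP/orP => -[/eqP|/eqP]; auto.
Qed.

Lemma adj_sym (G : graph) : symmetric (@adj G).
Proof.
move=> x y; apply/existsP/existsP => -[h]; rewrite andbC => /andP[h1 h2].
  by exists (opp h); rewrite oppK h1 h2.
by exists (opp h); rewrite oppK h1 h2.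
Qed.

Lemma connect_half (G : graph) (h : half G) :
  connect (@adj G) (inc h) (inc (opp h)).
Proof. by apply: connect1; apply/existsP; exists h; rewrite !eqxx. Qed.

Lemma connect_adjC (G : graph) : connect_sym (@adj G).
Proof. exact: sym_connect_sym (@adj_sym G). Qed.

Lemma betti1_connected (G : graph) : connected G ->
  betti1 G = (#|edges G| + 1 - #|vert G|)%N.
Proof.
case=> V_gt0 G_conn; rewrite /betti1; congr (_ + _ - _)%N.
have /card_gt0P[x0 _] := V_gt0.
rewrite -(n_comp_connect (connect_adjC (G := G)) x0).
by apply: eq_n_comp_r => x; rewrite /in_mem /= G_conn.
Qed.

Lemma leq3_valence (G : graph) (x : vert G) (h1 h2 h3 : half G) :
  h1 <> h2 -> h1 <> h3 -> h2 <> h3 -> inc h1 = x -> inc h2 = x -> inc h3 = x ->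
  (3 <= valence x)%N.
Proof.
move=> n12 n13 n23 e1 e2 e3.
have u : uniq [:: h1; h2; h3].
  by rewrite /= !inE negb_or; rewrite andbT -andbA; apply/and3P; split; apply/eqP.
rewrite -[3%N]/(size [:: h1; h2; h3]) -(card_uniqP u).
apply/subset_leq_card/subsetP => h; rewrite !inE => /or3P[]/eqP->;
  by rewrite ?e1 ?e2 ?e3.
Qed.

(** * Slots of the polygons *)

Lemma index_filter_neq (A : eqType) (s : seq A) (u v : A) :
  uniq s -> u \in s -> v \in s -> u != v ->
  index u [seq w <- s | w != v] = (index u s - (index v s < index u s))%N.
Proof.
elim: s => //= w s IHs /andP[w_s s_uniq]; rewrite !inE => us vs u_neq_v.
have [wv|w_neq_v] := eqVneq w v.
  subst w; rewrite (negPf u_neq_v) /= in us; rewrite eq_sym (negPf u_neq_v) /=.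
  rewrite subSS subn0; congr index; apply/all_filterP/allP => w ws.
  by apply: contraNneq w_s => <-.
rewrite /=; have [wu|w_neq_u] := eqVneq w u; first by [].
rewrite eq_sym (negPf w_neq_u) /= in us; rewrite eq_sym (negPf w_neq_v) /= in vs.
rewrite (IHs s_uniq us vs u_neq_v) ltnS.
have := index_mem u s; rewrite us => /esym lt_u.
by case: ltnP => // lt_vu; lia.
Qed.

Lemma size_filter_neq (A : eqType) (s : seq A) (v : A) :
  uniq s -> v \in s -> size [seq w <- s | w != v] = (size s).-1.
Proof. by move=> s_uniq vs; rewrite -rem_filter // size_rem. Qed.

Lemma index_rot (A : eqType) (s : seq A) (m : nat) (u : A) :
  uniq s -> u \in s -> (m <= size s)%N ->
  index u (rot m s) =
  if (index u s < m)%N then (index u s + (size s - m))%N else (index u s - m)%N.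
Proof.
move=> s_uniq us le_m; rewrite /rot index_cat size_drop.
have := s_uniq; rewrite -{1}(cat_take_drop m s) cat_uniq => /and3P[_ /hasPn dis _].
have e : index u s = if u \in take m s then index u (take m s)
                     else (m + index u (drop m s))%N.
  by rewrite -{1}(cat_take_drop m s) index_cat size_take_min (minn_idPl le_m).
have := us; rewrite -{1}(cat_take_drop m s) mem_cat e.
case: (boolP (u \in take m s)) => /= [ut _|ut ud].
  have lt_t : (index u (take m s) < m)%N.
    by have := index_mem u (take m s); rewrite ut size_takel.
  have /negPf -> : u \notin drop m s by apply: contraL ut => /dis.
  by rewrite lt_t addnC.
by rewrite ud ltnNge leq_addr /= addKn.
Qed.

Section Slots.
Variables (g : graph) (b : corner g).

(* The polygon at the vertex [tag b] receives an extra slot [None], inserted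
   right after [b]. *)
Definition slot := option (corner g).

Definition slot_tag (u : slot) : vert g := if u is Some c then tag c else tag b.

Definition slot_shift (x : vert g) : nat :=
  if x == tag b then (tagged b).+1 else 0%N.

(* In the polygon at [tag b] the slots are listed cyclically from the successor
   of [b], so that [b] and [None] come last. *)
Definition block (x : vert g) : seq slot :=
  [seq Some (Tagged (fun x => 'I_(valence x)) i)
     | i <- rot (slot_shift x) (enum 'I_(valence x))] ++ nseq (x == tag b) None.

Definition block_size (x : vert g) : nat := (valence x + (x == tag b))%N.

Definition slot_pos (u : slot) : nat := index u (block (slot_tag u)).

Definition slot_at (x : vert g) (j : nat) : slot := nth None (block x) j.

Definition slots : seq slot := flatten [seq block x | x <- enum (vert g)].

Lemma size_block x : size (block x) = block_size x.
Proof. by rewrite size_cat size_map size_rot size_enum_ord size_nseq. Qed.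

Lemma mem_block u x : (u \in block x) = (slot_tag u == x).
Proof.
rewrite mem_cat mem_nseq; case: u => [c|] /=; last first.
  rewrite andbT [tag b == x]eq_sym; case: eqP => [->|_]; rewrite ?orbT ?orbF //=.
  by apply/negP => /mapP[].
rewrite andbF orbF; apply/mapP/eqP => [[i _ [->]]//|<-].
by exists (tagged c); rewrite ?mem_rot ?mem_enum //; case: c.
Qed.

Lemma block_uniq x : uniq (block x).
Proof.
rewrite cat_uniq map_inj_uniq ?rot_uniq ?enum_uniq /=; last first.
  by move=> i j [/eqP]; rewrite -tag_eqE /tag_eq eqxx tagged_asE /= => /eqP.
case: (x == tag b) => //=; rewrite orbF andbT.
by apply/negP => /mapP[].
Qed.

Lemma slot_pos_lt u : (slot_pos u < block_size (slot_tag u))%N.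
Proof. by rewrite -size_block index_mem mem_block. Qed.

Lemma slot_at_pos u : slot_at (slot_tag u) (slot_pos u) = u.
Proof. by rewrite /slot_at nth_index // mem_block. Qed.

Lemma slot_pos_inj u v :
  slot_tag u = slot_tag v -> slot_pos u = slot_pos v -> u = v.
Proof. by move=> et ep; rewrite -(slot_at_pos u) et ep slot_at_pos. Qed.

Lemma slot_tag_at x j : (j < block_size x)%N -> slot_tag (slot_at x j) = x.
Proof. by move=> lt_j; apply/eqP; rewrite -mem_block mem_nth ?size_block. Qed.

Lemma slot_pos_at x j : (j < block_size x)%N -> slot_pos (slot_at x j) = j.
Proof.
move=> lt_j; rewrite /slot_pos slot_tag_at // index_uniq ?block_uniq //.
by rewrite size_block.
Qed.

Lemma slot_eqE u v :
  (u == v) = (slot_tag u == slot_tag v) && (slot_pos u == slot_pos v).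
Proof.
apply/eqP/andP => [->|[/eqP et /eqP ep]]; last exact: slot_pos_inj.
by rewrite !eqxx.
Qed.

Lemma slot_shift_le x : (slot_shift x <= valence x)%N.
Proof. by rewrite /slot_shift; case: eqP => // ->. Qed.

Lemma slot_pos_Some c : slot_pos (Some c) =
  if (tagged c < slot_shift (tag c))%N
  then (tagged c + (valence (tag c) - slot_shift (tag c)))%N
  else (tagged c - slot_shift (tag c))%N.
Proof.
have le_shift : (slot_shift (tag c) <= size (enum 'I_(valence (tag c))))%N.
  by rewrite size_enum_ord slot_shift_le.
rewrite /slot_pos index_cat.
have c_in : Some c \in [seq Some (Tagged (fun x => 'I_(valence x)) i)
    | i <- rot (slot_shift (tag c)) (enum 'I_(valence (tag c)))].
  by apply/mapP; exists (tagged c); rewrite ?mem_rot ?mem_enum //; case: c {le_shift}.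
rewrite c_in.
have -> : Some c = Some (Tagged (fun x => 'I_(valence x)) (tagged c)) by case: (c).
rewrite index_map; last first.
  by move=> i j [/eqP]; rewrite -tag_eqE /tag_eq eqxx tagged_asE /= => /eqP.
rewrite index_rot ?enum_uniq ?mem_enum // index_enum_ord size_enum_ord.
by [].
Qed.

Lemma slot_pos_None : slot_pos None = valence (tag b).
Proof.
rewrite /slot_pos index_cat /= ifN; last by apply/negP => /mapP[].
by rewrite size_map size_rot size_enum_ord eqxx addn0.
Qed.

Lemma slot_pos_Some_lt c : (slot_pos (Some c) < valence (tag c))%N.
Proof.
rewrite slot_pos_Some; have := ltn_ord (tagged c).
by have := slot_shift_le (tag c); case: ifP; lia.
Qed.

Lemma slot_pos_base : (slot_pos (Some b)).+1 = valence (tag b).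
Proof.
rewrite slot_pos_Some /slot_shift eqxx ltnSn.
by have := ltn_ord (tagged b); lia.
Qed.

Lemma slot_NoneP u : reflect (u = None)
  ((slot_tag u == tag b) && (slot_pos u == valence (tag b))).
Proof. by rewrite -slot_pos_None -[tag b]/(slot_tag None) -slot_eqE; apply: eqP. Qed.

Lemma slot_pos_corner_pred c : slot_pos (Some (corner_pred c)) =
  if slot_pos (Some c) == 0%N then (valence (tag c)).-1
  else (slot_pos (Some c)).-1.
Proof.
rewrite !slot_pos_Some /=; have lt_c := ltn_ord (tagged c).
have le_shift := slot_shift_le (tag c).
move: lt_c le_shift; move: (nat_of_ord (tagged c)) => i.
move: (valence (tag c)) (slot_shift (tag c)) => n m lt_i le_m.
have -> : ((i + n).-1 %% n)%N = if i == 0%N then n.-1 else i.-1.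
  case: eqP => [->|ne0]; first by rewrite add0n modn_small //; lia.
  have -> : ((i + n).-1 = i.-1 + n)%N by lia.
  by rewrite modnDr modn_small //; lia.
do ?case: ifP; lia.
Qed.

Definition slot_pred (u : slot) : slot :=
  if u is Some c then
    if (slot_pos u == 0%N) && (tag c == tag b) then None else Some (corner_pred c)
  else Some b.

Lemma slot_tag_pred u : slot_tag (slot_pred u) = slot_tag u.
Proof. by case: u => [c|] //=; case: ifP => //= /andP[_ /eqP]. Qed.

Lemma slot_pos_pred u : slot_pos (slot_pred u) =
  if slot_pos u == 0%N then (block_size (slot_tag u)).-1 else (slot_pos u).-1.
Proof.
case: u => [c|] /=; rewrite /block_size.
  case: (slot_pos (Some c) =P 0%N) => [p0|pn0] /=.
    case: eqP => [->|_]; first by rewrite slot_pos_None addn1.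
    by rewrite slot_pos_corner_pred p0 addn0.
  by rewrite slot_pos_corner_pred; case: eqP.
by rewrite slot_pos_None -slot_pos_base.
Qed.

Lemma slots_flatten_uniq (r : seq (vert g)) :
  uniq r -> uniq (flatten [seq block x | x <- r]).
Proof.
elim: r => //= x r IHr /andP[x_r r_uniq].
rewrite cat_uniq block_uniq IHr //= andbT.
apply/hasPn => u /flatten_mapP[y yr]; rewrite !mem_block => /eqP eu.
by apply: contraNneq x_r => <-; rewrite eu.
Qed.

Lemma slots_uniq : uniq slots.
Proof. exact/slots_flatten_uniq/enum_uniq. Qed.

Lemma mem_slots u : u \in slots.
Proof.
apply/flatten_mapP; exists (slot_tag u); first exact: mem_enum.
by rewrite mem_block.
Qed.

(** Plain functions with a constraint, rather than dependent ones, so that values can be overwritten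
    by a slot and moved by a permutation of slots. *)
Definition choices : {pred {ffun vert g -> slot}} :=
  [pred d : {ffun vert g -> slot} | [forall x, slot_tag (d x) == x]].

Lemma choicesP (d : {ffun vert g -> slot}) :
  reflect (forall x, slot_tag (d x) = x) (d \in choices).
Proof. by rewrite inE; apply: (iffP forallP) => h x; apply/eqP/h. Qed.

Definition kept (d : {ffun vert g -> slot}) : seq slot :=
  [seq u <- slots | u != d (slot_tag u)].

Lemma kept_uniq d : uniq (kept d).
Proof. exact/filter_uniq/slots_uniq. Qed.

Lemma mem_kept d u : (u \in kept d) = (u != d (slot_tag u)).
Proof. by rewrite mem_filter mem_slots andbT. Qed.

Lemma kept_block d x :
  [seq u <- block x | u != d (slot_tag u)] = [seq u <- block x | u != d x].
Proof. by apply: eq_in_filter => u; rewrite mem_block => /eqP ->. Qed.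

Lemma size_kept_flatten d (r : seq (vert g)) : d \in choices ->
  size [seq u <- flatten [seq block x | x <- r] | u != d (slot_tag u)] =
  (\sum_(x <- r) (block_size x).-1)%N.
Proof.
move=> dC; elim: r => [|x r IHr] /=; first by rewrite big_nil.
rewrite filter_cat size_cat IHr big_cons kept_block // size_filter_neq.
- by rewrite size_block.
- exact: block_uniq.
- by rewrite mem_block (choicesP _ dC).
Qed.

Lemma size_kept d : d \in choices ->
  size (kept d) = (\sum_(x : vert g) (block_size x).-1)%N.
Proof. by move=> dC; rewrite size_kept_flatten // big_enum. Qed.

(** The number of forest edges in the polygons listed before that of [x], which is the same for all
    choices. *)
Definition slot_offset (x : vert g) : nat :=
  (\sum_(y <- take (index x (enum (vert g))) (enum (vert g))) (block_size y).-1)%N.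

Lemma index_kept d u : d \in choices -> u != d (slot_tag u) ->
  index u (kept d) = (slot_offset (slot_tag u) +
    (slot_pos u - (slot_pos (d (slot_tag u)) < slot_pos u)))%N.
Proof.
move=> dC u_d; set x := slot_tag u in u_d *.
rewrite /kept /slots /slot_offset.
have := enum_uniq (vert g).
have : x \in enum (vert g) by rewrite mem_enum.
case/splitPr => r1 r2; rewrite cat_uniq => /and3P[_ /hasPn/(_ x (mem_head _ _)) x_r1 _].
rewrite index_cat (negPf x_r1) /= eqxx addn0 take_size_cat //.
rewrite map_cat flatten_cat /= filter_cat index_cat ifN; last first.
  apply: contra x_r1; rewrite mem_filter => /andP[_ /flatten_mapP[y yr]].
  by rewrite mem_block /x => /eqP ->.
rewrite size_kept_flatten //; congr addn.
rewrite filter_cat index_cat mem_filter u_d mem_block eqxx /= kept_block //.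
rewrite index_filter_neq ?block_uniq ?mem_block ?(choicesP _ dC) //.
by rewrite /slot_pos (choicesP _ dC).
Qed.

End Slots.

(** * Signed sums over deleted edges and over arrangements *)

Lemma big_seq_uniq (A : finType) (r : seq A) (F : A -> rat) :
  uniq r -> \sum_(u <- r) F u = \sum_(u | u \in r) F u.
Proof. by move=> r_uniq; rewrite -big_uniq. Qed.

Lemma signr_oddN (m n : nat) : odd m = ~~ odd n -> (-1) ^+ m = - (-1) ^+ n :> rat.
Proof. by rewrite -(signr_odd _ m) -(signr_odd _ n) => ->; rewrite signrN. Qed.

Lemma signr_odd_eq (m n : nat) : odd m = odd n -> (-1) ^+ m = (-1) ^+ n :> rat.
Proof. by rewrite -(signr_odd _ m) -(signr_odd _ n) => ->. Qed.

Section SlotSums.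
Variables (g : graph) (b : corner g).
Local Notation slot := (slot g).
Local Notation tg := (slot_tag b).
Local Notation ps := (slot_pos b).
Local Notation kept := (kept b).
Local Notation choices := (choices b).

Definition sign_choice (d : {ffun vert g -> slot}) : rat :=
  \prod_(x : vert g) (-1) ^+ ps (d x).

(** The predicate [Q] serves to forbid [None]: the forests of Z always contain the edge with this
    label. *)
Definition choices_in (Q : pred slot) : {pred {ffun vert g -> slot}} :=
  [pred d | (d \in choices) && [forall x, Q (d x)]].

Definition set_choice (d : {ffun vert g -> slot}) (u : slot) :=
  [ffun x => if x == tg u then u else d x].

Lemma set_choice_tag d u : set_choice d u (tg u) = u.
Proof. by rewrite ffunE eqxx. Qed.

Lemma set_choice_choices d u : d \in choices -> set_choice d u \in choices.
Proof.
move=> dC; apply/choicesP => x; rewrite ffunE; case: eqP => [->//|_].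
exact/choicesP.
Qed.

Lemma set_choice_in Q d u : d \in choices_in Q -> Q u ->
  set_choice d u \in choices_in Q.
Proof.
case/andP=> dC /forallP dQ Qu; apply/andP; split; first exact: set_choice_choices.
by apply/forallP => x; rewrite ffunE; case: ifP.
Qed.

(** Both exponents are the sum of the positions of the two slots and a common offset, lowered by one
    if the slot deleted first precedes the other. This happens for exactly one of the two orders. *)
Lemma sign_choice_kept d u : d \in choices -> u != d (tg u) ->
  sign_choice (set_choice d u) * (-1) ^+ index (d (tg u)) (kept (set_choice d u)) =
  - (sign_choice d * (-1) ^+ index u (kept d)).
Proof.
move=> dC u_d; set v := d (tg u) in u_d *.
have tv : tg v = tg u by apply/choicesP.
have d'C := set_choice_choices u dC.
have vd : v != set_choice d u (tg v) by rewrite tv set_choice_tag eq_sym.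
rewrite (index_kept dC u_d) (index_kept d'C vd) tv set_choice_tag -/v.
rewrite /sign_choice (bigD1 (tg u)) //= [in RHS](bigD1 (tg u)) //=.
rewrite set_choice_tag -/v.
rewrite (eq_bigr (fun x => (-1) ^+ ps (d x))); last first.
  by move=> x /negPf xu; rewrite ffunE xu.
set P := \prod_(_ | _) _; rewrite ![_ * P * _]mulrAC -!exprD -mulNr.
congr (_ * P).
have : ps u != ps v.
  by apply: contraNneq u_d => e; apply/eqP/(slot_pos_inj _ e); rewrite tv.
set o := slot_offset _ _; move: (ps u) (ps v) => m n.
by rewrite neq_ltn => /orP[] lt_mn; apply: signr_oddN; lia.
Qed.

Lemma sum_opp0 (A : finType) (P : pred A) (f : A -> A) (F : A -> rat) :
  (forall x, P x -> P (f x)) -> (forall x, P x -> f (f x) = x) ->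
  (forall x, P x -> F (f x) = - F x) -> \sum_(x | P x) F x = 0.
Proof.
move=> Pf ff Ff; set S := \sum_(_ | _) _.
suff : S = - S by move=> e; lra.
rewrite {1}/S (reindex_onto f f) //= -sumrN; apply: congr_big => // x.
  apply/andP/idP => [[Pfx /eqP e]|Px]; first by rewrite -e; apply: Pf.
  by rewrite Pf ?ff ?eqxx.
move=> /andP[Pfx /eqP e]; apply: Ff; rewrite -e; exact: Pf.
Qed.

(* Deleting the edge [u] after [v = d (tag u)] gives the same forest as deleting
   them in the opposite order, with the opposite sign. *)
Lemma sum_removals0 (Q : pred slot) (psi : seq slot -> rat) :
  \sum_(d in choices_in Q) \sum_(u | Q u && (u != d (tg u)))
    sign_choice d * (-1) ^+ index u (kept d) * psi [seq v <- kept d | v != u] = 0.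
Proof.
rewrite pair_big_dep /=.
apply: (@sum_opp0 _ _ (fun p => (set_choice p.1 p.2, p.1 (tg p.2)))).
- case=> d u /= /and3P[dQ Qu u_d]; have /andP[dC /forallP Qd] := dQ.
  rewrite set_choice_in // Qd /=.
  by rewrite (choicesP _ _ dC) set_choice_tag eq_sym.
- case=> d u /= /and3P[dQ Qu u_d]; have /andP[dC /forallP Qd] := dQ.
  rewrite (choicesP _ _ dC) set_choice_tag; congr pair; apply/ffunP => x.
  rewrite !ffunE (choicesP _ _ dC); case: eqP => // ->; exact.
case=> d u /= /and3P[dQ Qu u_d]; have /andP[dC /forallP Qd] := dQ.
rewrite sign_choice_kept // mulNr; congr (- (_ * psi _)).
rewrite -!filter_predI; apply: eq_filter => v /=.
rewrite ffunE; case: (eqVneq (tg v) (tg u)) => [->|v_u].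
  by rewrite andbC.
rewrite andbC [RHS]andbC; congr (_ && _).
have /negPf -> : v != d (tg u).
  by apply: contraNneq v_u => ->; rewrite (choicesP _ _ dC).
by have /negPf -> : v != u by apply: contraNneq v_u => ->.
Qed.

(** Such a permutation is an arrangement: it sends each object, a half-edge for [Some c] and the
    loop end for [None], to its place in the same polygon. *)
Definition slot_perms : {pred {perm slot}} :=
  [pred s : {perm slot} | [forall u, tg (s u) == tg u]].

Lemma slot_permsP (s : {perm slot}) :
  reflect (forall u, tg (s u) = tg u) (s \in slot_perms).
Proof. by rewrite inE; apply: (iffP forallP) => h u; apply/eqP/h. Qed.

Lemma slot_perms_mul (s t : {perm slot}) :
  s \in slot_perms -> t \in slot_perms -> (s * t)%g \in slot_perms.
Proof.
by move=> sP tP; apply/slot_permsP => u; rewrite permM !(slot_permsP _ _).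
Qed.

Lemma slot_perms_tperm (u v : slot) : tg u = tg v -> tperm u v \in slot_perms.
Proof. by move=> e; apply/slot_permsP => w; case: tpermP => // ->. Qed.

(** Multiplication by the transposition reverses the sign and keeps [K]. It cancels the arrangements
    whose loop end is at neither place and exchanges the two families with the loop end at [u] or
    [v], so only the jump of the weight is left. *)
Lemma sum_swap (u v : slot) (w : slot -> rat) (K : {perm slot} -> rat) :
  u != v -> tg u = tg v ->
  (forall s, s \in slot_perms -> K (s * tperm u v)%g = K s) ->
  \sum_(s in slot_perms) (-1) ^+ odd_perm s * w (s None) * K s =
  (w v - w u) * \sum_(s in slot_perms | s None == v) (-1) ^+ odd_perm s * K s.
Proof.
move=> u_v euv Kt; set t := tperm u v in Kt *.
have tP : t \in slot_perms by apply: slot_perms_tperm.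
have tt (s : {perm slot}) : (s * t * t)%g = s by rewrite -mulgA tperm2 mulg1.
have odd_t (s : {perm slot}) : odd_perm (s * t)%g = ~~ odd_perm s.
  by rewrite odd_permM odd_tperm u_v addbT.
have st (s : {perm slot}) : ((s * t)%g \in slot_perms) = (s \in slot_perms).
  by apply/idP/idP => sP; first rewrite -(tt s); apply: slot_perms_mul.
rewrite (bigID (fun s : {perm slot} => s None == v)) /=.
rewrite [X in _ + X](bigID (fun s : {perm slot} => s None == u)) /=.
rewrite [X in _ + (_ + X)](@sum_opp0 _ _ (fun s => (s * t)%g)) ?addr0.
- rewrite mulrBl; congr (_ + _).
    by rewrite mulr_sumr; apply: eq_bigr => s /andP[_ /eqP->]; rewrite mulrCA mulrA.
  rewrite (reindex_onto (fun s => (s * t)%g) (fun s => (s * t)%g)) /=; last first.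
    by move=> s _; rewrite tt.
  rewrite mulr_sumr -sumrN; apply: congr_big => // s.
    rewrite st tt eqxx andbT permM -andbA; congr (_ && _).
    apply/andP/eqP => [[_ /eqP e]|->]; last by rewrite tpermR eqxx u_v.
    by apply: (perm_inj (s := t)); rewrite e tpermR.
  move=> /andP[/andP[/andP[sP _] /eqP ->]] _.
  rewrite st in sP; rewrite odd_t Kt // signrN !mulNr.
  by rewrite mulrCA mulrA.
- move=> s /andP[/andP[sP nv] nu]; rewrite st sP permM /=.
  have -> : t (s None) = s None by rewrite /t tpermD // eq_sym.
  by rewrite nv nu.
- by move=> s _; rewrite tt.
move=> s /andP[/andP[sP nv] nu]; rewrite odd_t Kt // permM.
have -> : t (s None) = s None by rewrite /t tpermD // eq_sym.
by rewrite signrN !mulNr.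
Qed.

End SlotSums.

(** * The families X and Z *)

Lemma collapse_ends (G : graph) (e : {set half G}) (x y : vert G) :
  x \in ends e -> y \in ends e -> collapse e x = collapse e y.
Proof. by rewrite /collapse => -> ->. Qed.

Lemma collapse_tperm (G : graph) (e : {set half G}) (x y z : vert G) :
  x \in ends e -> y \in ends e -> collapse e (tperm x y z) = collapse e z.
Proof.
by move=> xe ye; case: tpermP => // ->; apply: collapse_ends.
Qed.

Section Graphs.
Variables (g : graph) (o : vertex_ordering g) (b : corner g).
Local Notation slot := (slot g).
Local Notation tg := (slot_tag b).
Local Notation ps := (slot_pos b).

Definition half_corner (h : half g) : corner g :=
  Tagged (fun x => 'I_(valence x)) (pos o h).

(* Half-edges of g, the two halves of the added loop, and the two halves of one
   further edge per slot. *)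
Definition slot_half := (half g + bool + slot * bool)%type.

Definition slot_opp (h : slot_half) : slot_half :=
  match h with
  | inl (inl h) => inl (inl (opp h))
  | inl (inr c) => inl (inr (~~ c))
  | inr (u, c) => inr (u, ~~ c)
  end.

Lemma slot_oppK : involutive slot_opp.
Proof. by case=> [[h|c]|[u c]] /=; rewrite ?oppK ?negbK. Qed.

Lemma slot_opp_neq h : slot_opp h != h.
Proof.
case: h => [[h|c]|[u c]] /=.
- by apply: contraNneq (opp_neq h) => -[->].
- by apply/eqP => -[]; case: c.
by apply/eqP => -[]; case: c.
Qed.

(** All these graphs share vertices, half-edges and pairing, so that an edge of one can be used
    verbatim in another. *)
Definition slot_graph (i : slot_half -> slot) : graph :=
  @Graph slot slot_half i slot_opp slot_oppK slot_opp_neq.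

Definition slot_edge (i : slot_half -> slot) (u : slot) :
    {set half (slot_graph i)} := @edge (slot_graph i) (inr (u, false)).

Definition loop_edge (i : slot_half -> slot) : {set half (slot_graph i)} :=
  @edge (slot_graph i) (inl (inr false)).

(* The polygon at [tag b] is enlarged by [None], which becomes the basepoint
   and one end of the loop; [s None] is the other end of the loop. *)
Definition incX (s : {perm slot}) (h : slot_half) : slot :=
  match h with
  | inl (inl h) => s (Some (half_corner h))
  | inl (inr c) => if c then s None else None
  | inr (u, c) => if c then u else slot_pred b u
  end.

(* The loop is subdivided by [None] into an edge from the basepoint to [None]
   and the edge of [None], which joins [s None] to [None]. *)
Definition incZ (s : {perm slot}) (h : slot_half) : slot :=
  match h with
  | inl (inl h) => s (Some (half_corner h))
  | inl (inr c) => if c then None else Some b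
  | inr (u, c) => if c then u else if u is Some c then Some (corner_pred c) else s None
  end.

(** The second forest for Z: the label [None] now stands for the half of the subdivided loop at the
    basepoint. *)
Definition labelZ (i : slot_half -> slot) (u : slot) : {set half (slot_graph i)} :=
  if u == None then loop_edge i else slot_edge i u.

Section Contractions.
Variables (phi : triple -> rat) (phi_inv : invariant phi).

Definition contraction (i : slot_half -> slot) (e : {set slot_half}) (u : slot)
    (F : slot -> {set slot_half}) (M : seq slot) : rat :=
  phi (@Triple (contract (e : {set half (slot_graph i)}))
         (contract_vert (e : {set half (slot_graph i)}) (u : vert (slot_graph i)))
         [seq contract_edge (e : {set half (slot_graph i)}) (F v) | v <- M]).

Lemma contraction_same (i j : slot_half -> slot) (h0 : slot_half) (u : slot) F M :
  [set j h0; j (slot_opp h0)] = [set i h0; i (slot_opp h0)] ->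
  (forall h, i h = j h \/ exists2 w, i h = tperm (i h0) (i (slot_opp h0)) w & j h = w) ->
  contraction i (@edge (slot_graph i) h0) u F M =
  contraction j (@edge (slot_graph i) h0) u F M.
Proof.
move=> e_ends ij; apply: (proj1 phi_inv).
have ends_j : ends (@edge (slot_graph j) h0) = [set i h0; i (slot_opp h0)].
  by rewrite (@ends_edge (slot_graph j)).
apply: (@triple_iso_contract (slot_graph i) (slot_graph j) _ _ u u _ _ F F id id)
  => //.
- by move=> y; exists y.
- by move=> y; exists y.
- by rewrite imset_id.
- by rewrite imset_id (@ends_edge (slot_graph j)) (@ends_edge (slot_graph i)).
- move=> h _ /=; case: (ij h) => [->//|[w -> ->]].
  by rewrite collapse_tperm // ends_j !inE eqxx ?orbT.
by move=> v; rewrite imset_id.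
Qed.

Lemma contractionX_tperm s u F M :
  contraction (incX (s * tperm u (slot_pred b u))) (slot_edge (incX s) u) None F M =
  contraction (incX s) (slot_edge (incX s) u) None F M.
Proof.
apply: contraction_same => //= -[[h|[]]|[v c]] /=; try by left.
  by right; exists (s (Some (half_corner h))); rewrite // permM tpermC.
by right; exists (s None); rewrite // permM tpermC.
Qed.

Lemma contractionZ_tperm s c F M :
  contraction (incZ (s * tperm (Some c) (Some (corner_pred c))))
    (slot_edge (incZ s) (Some c)) (Some b) F M =
  contraction (incZ s) (slot_edge (incZ s) (Some c)) (Some b) F M.
Proof.
apply: contraction_same => //= -[[h|[]]|[[v|] [|]]] /=; try by left.
  by right; exists (s (Some (half_corner h))); rewrite // permM tpermC.
by right; exists (s None); rewrite // permM tpermC.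
Qed.

Lemma contractionZ_loop_tperm s F M :
  contraction (incZ (s * tperm None (Some b))) (loop_edge (incZ s)) (Some b) F M =
  contraction (incZ s) (loop_edge (incZ s)) (Some b) F M.
Proof.
apply: contraction_same => //= -[[h|[]]|[[v|] [|]]] /=; try by left.
  by right; exists (s (Some (half_corner h))); rewrite // permM tpermC.
by right; exists (s None); rewrite // permM tpermC.
Qed.

Definition swap_loop (h : slot_half) : slot_half :=
  match h with
  | inl (inr c) => inr (None, c)
  | inr (None, c) => inl (inr c)
  | _ => h
  end.

Lemma swap_loopK : involutive swap_loop.
Proof. by case=> [[h|c]|[[v|] c]]. Qed.

(** In this case both halves of the subdivided loop join the basepoint to [None], and exchanging
    them is an automorphism of the graph. *)
Lemma contractionZ_swap_loop (s : {perm slot}) M : s None = Some b ->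
  contraction (incZ s) (slot_edge (incZ s) None) (Some b) (slot_edge (incZ s)) M =
  contraction (incZ s) (loop_edge (incZ s)) (Some b) (labelZ (incZ s)) M.
Proof.
move=> sN; apply: (proj1 phi_inv).
have g_inc h : incZ s (swap_loop h) = incZ s h.
  by case: h => [[h|[]]|[[v|] []]] //=; rewrite sN.
have g_edge (h : half (slot_graph (incZ s))) :
    swap_loop @: edge h = @edge (slot_graph (incZ s)) (swap_loop h).
  rewrite /edge imsetU1 imset_set1; congr [set _; _].
  by case: h => [[h|[]]|[[v|] []]].
apply: (@triple_iso_contract (slot_graph (incZ s)) (slot_graph (incZ s)) _ _ _ _ _ _
  (slot_edge (incZ s)) (labelZ (incZ s)) id swap_loop) => //.
- by move=> y; exists y.
- exact: can_inj swap_loopK.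
- by move=> y; exists (swap_loop y); rewrite swap_loopK.
- by case=> [[h|[]]|[[v|] []]].
- by rewrite g_edge.
- rewrite imset_id !(@ends_edge (slot_graph (incZ s))) /=.
  by rewrite sN setUC.
- by move=> h _; rewrite /= g_inc.
by case=> [c|]; rewrite /labelZ /= g_edge.
Qed.

End Contractions.
End Graphs.

(** * The renaming of slots that turns contractions in X into contractions in Z *)

Section Cycles.
Variables (g : graph) (o : vertex_ordering g) (b : corner g).
Local Notation slot := (slot g).
Local Notation tg := (slot_tag b).
Local Notation ps := (slot_pos b).
Local Notation k := (valence (tag b)).
Local Notation at0 := (slot_at b (tag b)).

Lemma block_size_base : block_size b (tag b) = k.+1.
Proof. by rewrite /block_size eqxx addn1. Qed.

Lemma slot_at0_tag j : (j <= k)%N -> tg (at0 j) = tag b.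
Proof. by move=> le_j; rewrite slot_tag_at // block_size_base. Qed.

Lemma slot_at0_pos j : (j <= k)%N -> ps (at0 j) = j.
Proof. by move=> le_j; rewrite slot_pos_at // block_size_base. Qed.

(* The cycle moving the slot in position [k - m] to the last position [k]. *)
Fixpoint slot_cycle (m : nat) : {perm slot} :=
  if m is m'.+1 then (tperm (at0 (k - m'.+1)) (at0 (k - m')) * slot_cycle m')%g
  else 1%g.

Definition cycle_pos (m p : nat) : nat :=
  if (p < k - m)%N then p else if p == (k - m)%N then k else p.-1.

Lemma slot_cycleE m u : (m <= k)%N ->
  tg (slot_cycle m u) = tg u /\
  ps (slot_cycle m u) = if tg u == tag b then cycle_pos m (ps u) else ps u.
Proof.
elim: m u => [|m IHm] u le_m /=.
  rewrite perm1 /cycle_pos subn0; split=> //; case: eqP => // tu.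
  by have := slot_pos_lt b u; rewrite tu block_size_base; do ![case: ifP]; lia.
have [le1 le2] : (k - m.+1 <= k)%N /\ (k - m <= k)%N by lia.
rewrite permM; have [t p] := IHm (tperm (at0 (k - m.+1)) (at0 (k - m)) u) (ltnW le_m).
rewrite {}t {}p; case: tpermP => [->|->|/eqP n1 /eqP n2].
- rewrite !slot_at0_tag // !slot_at0_pos // eqxx; split=> //.
  by rewrite /cycle_pos ltnn eqxx ltnn eqxx.
- rewrite !slot_at0_tag // !slot_at0_pos // eqxx; split=> //.
  by rewrite /cycle_pos; do ![case: ifP]; lia.
split=> //; case: eqP => // tu.
have p1 : ps u != (k - m.+1)%N.
  by apply: contraNneq n1 => e; rewrite (slot_eqE b) slot_at0_tag // tu e slot_at0_pos // !eqxx.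
have p2 : ps u != (k - m)%N.
  by apply: contraNneq n2 => e; rewrite (slot_eqE b) slot_at0_tag // tu e slot_at0_pos // !eqxx.
by rewrite /cycle_pos; do ![case: ifP]; lia.
Qed.

Lemma odd_slot_cycle m : (m <= k)%N -> odd_perm (slot_cycle m) = odd m.
Proof.
elim: m => [|m IHm] le_m /=; first by rewrite odd_perm1.
rewrite odd_permM IHm 1?ltnW // odd_tperm (slot_eqE b) !slot_at0_pos; try lia.
Qed.

Variable j : nat.
Hypotheses (j_gt0 : (0 < j)%N) (j_lt : (j < k)%N).
Let r := slot_cycle (k - j).

Lemma slot_cycle_tag u : tg (r u) = tg u.
Proof. by case: (slot_cycleE u (leq_subr j k)). Qed.

Lemma slot_cycle_pos u : ps (r u) =
  if tg u == tag b then
    if (ps u < j)%N then ps u else if ps u == j then k else (ps u).-1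
  else ps u.
Proof.
by case: (slot_cycleE u (leq_subr j k)) => _ ->; rewrite /cycle_pos subKn // ltnW.
Qed.

Lemma slot_cycle_at : r (at0 j) = None.
Proof.
have le_j := ltnW j_lt.
apply: (slot_pos_inj (b := b)); first by rewrite slot_cycle_tag slot_at0_tag.
by rewrite slot_cycle_pos slot_at0_tag // eqxx slot_at0_pos // ltnn eqxx slot_pos_None.
Qed.

Lemma slot_cycle_None : r None = Some b.
Proof.
apply: (slot_pos_inj (b := b)); first by rewrite slot_cycle_tag.
rewrite slot_cycle_pos /= eqxx slot_pos_None -slot_pos_base /=.
have := slot_pos_base b; do ![case: ifP]; lia.
Qed.

(** As [j] is positive, the predecessor has position [j - 1], below the range in which the cycle
    moves anything. *)
Lemma slot_cycle_pred : r (slot_pred b (at0 j)) = slot_pred b (at0 j).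
Proof.
have le_j := ltnW j_lt.
apply: (slot_pos_inj (b := b)); first by rewrite slot_cycle_tag.
rewrite slot_cycle_pos slot_tag_pred slot_at0_tag // eqxx slot_pos_pred slot_at0_pos //.
by rewrite slot_at0_tag // block_size_base; do ![case: ifP]; lia.
Qed.

(** The renaming takes [at0 j] to the middle of the loop and the basepoint [None] of X to the
    basepoint [Some b] of Z, and closes up the other places to a k-gon. In both graphs the
    contraction then brings the loop end together with a half-edge on this k-gon. *)
Lemma contraction_slot_cycle phi (s : {perm slot}) M : invariant phi ->
  s \in slot_perms b -> s None = slot_pred b (at0 j) ->
  contraction phi (incX o b s) (slot_edge (incX o b s) (at0 j)) None
    (slot_edge (incX o b s)) M =
  contraction phi (incZ o b (s * r)) (slot_edge (incZ o b (s * r)) None) (Some b)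
    (slot_edge (incZ o b (s * r))) [seq r v | v <- M].
Proof.
move=> phi_inv sP sN.
pose f (h : slot_half g) : slot_half g := if h is inr (u, c) then inr (r u, c) else h.
pose f' (h : slot_half g) : slot_half g :=
  if h is inr (u, c) then inr ((r^-1)%g u, c) else h.
have ff' : cancel f f' by case=> [h|[u c]] //=; rewrite permK.
have f'f : cancel f' f by case=> [h|[u c]] //=; rewrite permKV.
have f_edge (h : slot_half g) (i i' : slot_half g -> slot) :
    f @: @edge (slot_graph i) h = @edge (slot_graph i') (f h).
  by rewrite /edge imsetU1 imset_set1; congr [set _; _]; case: h => [[h|c]|[u c]].
have pred_at0 : slot_pred b (at0 j) \in
    ends (slot_edge (incZ o b (s * r)) None).
  by rewrite (@ends_edge (slot_graph _)) !inE /= permM sN slot_cycle_pred eqxx.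
have None_ends : None \in ends (slot_edge (incZ o b (s * r)) None).
  by rewrite (@ends_edge (slot_graph _)) !inE eqxx orbT.
rewrite /contraction -map_comp; apply: (proj1 phi_inv).
apply: (@triple_iso_contract (slot_graph (incX o b s))
  (slot_graph (incZ o b (s * r))) _ _ _ _ _ _ (slot_edge _)
  (fun v => slot_edge (incZ o b (s * r)) (r v)) r f) => //.
- exact: perm_inj.
- by move=> y; exists ((r^-1)%g y); rewrite permKV.
- exact: can_inj ff'.
- by move=> y; exists (f' y).
- by case=> [[h|c]|[u c]].
- by rewrite /slot_edge (f_edge _ _ (incZ o b (s * r))) /= slot_cycle_at.
- rewrite !(@ends_edge (slot_graph _)) /= imsetU1 imset_set1 permM sN.
  by rewrite slot_cycle_at slot_cycle_pred.
- case=> [[h|[]]|[u c]] h_ne /=.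
  + by rewrite permM.
  (* The loop ends at the predecessor of [at0 j] in X and at [None] in Z: the two ends of the
     contracted edge. *)
  + by rewrite sN slot_cycle_pred; apply: (collapse_ends (G := slot_graph _) None_ends pred_at0).
  + by rewrite slot_cycle_None.
  have {h_ne} u_j : u != at0 j.
    apply: contraNneq h_ne => ->; rewrite /slot_edge mem_edge /=.
    by case: c; rewrite eqxx ?orbT.
  case: c => //.
  have ru : r u != None by rewrite -slot_cycle_at (inj_eq perm_inj).
  case er : (r u) ru => [c|] // _.
  (* The edge after the contracted one starts at [at0 j], renamed [None], in X but at the
     predecessor of [at0 j] in Z. These two vertices are merged. *)
  have [pu|pu] := eqVneq (slot_pred b u) (at0 j).
    rewrite pu slot_cycle_at; suff -> : Some (corner_pred c) = slot_pred b (at0 j).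
      by apply: (collapse_ends (G := slot_graph _) pred_at0 None_ends).
    have tu : tg u = tag b by rewrite -(slot_tag_pred b u) pu slot_at0_tag // ltnW.
    have tc : tag c = tag b by rewrite -[tag c]/(tg (Some c)) -er slot_cycle_tag.
    apply: (slot_pos_inj (b := b)); rewrite ?slot_tag_pred ?slot_at0_tag ?(ltnW j_lt) //.
    have := slot_pos_pred b u; rewrite pu slot_pos_corner_pred -er slot_pos_pred.
    rewrite slot_cycle_pos tu tc eqxx slot_at0_tag ?slot_at0_pos ?(ltnW j_lt) //.
    by rewrite block_size_base; do ![case: ifP]; lia.
  suff -> : Some (corner_pred c) = r (slot_pred b u) by [].
  apply: (slot_pos_inj (b := b)).
    by rewrite slot_cycle_tag slot_tag_pred /= -[tag c]/(tg (Some c)) -er slot_cycle_tag.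
  have tc : tag c = tg u by rewrite -[tag c]/(tg (Some c)) -er slot_cycle_tag.
  rewrite slot_pos_corner_pred -er !slot_cycle_pos slot_tag_pred slot_pos_pred tc.
  case: (tg u =P tag b) => [tu|/eqP/negPf tu]; last first.
    by rewrite /block_size tu addn0.
  rewrite tu block_size_base; have := slot_pos_lt b u; rewrite tu block_size_base.
  move: u_j pu; rewrite !(slot_eqE b) slot_tag_pred slot_at0_tag ?slot_at0_pos ?(ltnW j_lt) //.
  rewrite tu eqxx /= slot_pos_pred tu block_size_base.
  by do ![case: ifP]; lia.
- by rewrite slot_cycle_None.
by move=> v; rewrite /slot_edge (f_edge _ _ (incZ o b (s * r))).
Qed.

End Cycles.

Section CycleSums.
Variables (g : graph) (o : vertex_ordering g) (b : corner g).
Local Notation slot := (slot g).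
Local Notation tg := (slot_tag b).
Local Notation ps := (slot_pos b).
Local Notation k := (valence (tag b)).
Local Notation at0 := (slot_at b (tag b)).
Variable j : nat.
Hypotheses (j_gt0 : (0 < j)%N) (j_lt : (j < k)%N).
Let r := slot_cycle b (k - j).

Definition cycle_choice (d : {ffun vert g -> slot}) : {ffun vert g -> slot} :=
  [ffun x => r (d x)].

Lemma cycle_choice_choices d : (cycle_choice d \in choices b) = (d \in choices b).
Proof.
apply/choicesP/choicesP => dC x; have := dC x; rewrite ffunE;
  by rewrite slot_cycle_tag // ltnW.
Qed.

(** As [None] is last in its block, sending place [j] there keeps the order of all other slots. The
    forests therefore agree as lists, and no reordering sign appears. *)
Lemma map_slot_cycle_block x :
  [seq r v | v <- block b x & v != at0 j] = [seq v <- block b x | v != None].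
Proof.
have le_j := ltnW j_lt; have le_kj : (k - j <= k)%N by apply: leq_subr.
have [->|x_b] := eqVneq x (tag b); last first.
  have eq_all (u : slot) : tg u = tag b ->
      [seq v <- block b x | v != u] = block b x.
    move=> tu; apply/all_filterP/allP => v; rewrite mem_block => /eqP tv.
    by apply: contraNneq x_b => e; rewrite -tv e tu.
  rewrite !eq_all ?slot_at0_tag //; apply: map_id_in => v; rewrite mem_block => /eqP tv.
  apply: (slot_pos_inj (b := b)); first by rewrite slot_cycle_tag.
  by rewrite slot_cycle_pos // tv (negPf x_b).
rewrite -!rem_filter ?block_uniq // !remE.
have -> : index (at0 j) (block b (tag b)) = j.
  by rewrite -[RHS](slot_at0_pos (b := b) le_j) /slot_pos slot_at0_tag.
have -> : index None (block b (tag b)) = k by rewrite -slot_pos_None.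
have sz : size (block b (tag b)) = k.+1 by rewrite size_block block_size_base.
rewrite [drop k.+1 _]drop_oversize ?sz // cats0.
have szl : size (take j (block b (tag b)) ++ drop j.+1 (block b (tag b))) = k.
  by rewrite size_cat size_takel ?sz 1?leqW // size_drop sz; lia.
apply: (@eq_from_nth _ None) => [|i]; first by rewrite size_map szl size_takel ?sz.
rewrite size_map szl => lt_i; rewrite (nth_map None) ?szl // nth_take //.
rewrite nth_cat size_takel ?sz 1?leqW // nth_drop.
have -> : (if (i < j)%N then nth None (take j (block b (tag b))) i
           else nth None (block b (tag b)) (j.+1 + (i - j))) = at0 (bump j i).
  rewrite /bump; case: ltnP => lt_ij; first by rewrite nth_take.
  by rewrite /slot_at; congr nth; lia.
have lt_bi : (bump j i <= k)%N by rewrite /bump; lia.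
rewrite -/(at0 i); apply: (slot_pos_inj (b := b)).
  by rewrite slot_cycle_tag // !slot_at0_tag // ltnW.
rewrite slot_cycle_pos // slot_at0_tag // eqxx !slot_at0_pos ?(ltnW lt_i) //.
by rewrite /bump; do ![case: ifP]; lia.
Qed.

Lemma map_slot_cycle_kept d : d \in choices b -> d (tag b) != at0 j ->
  [seq r v | v <- kept b d & v != at0 j] =
  [seq v <- kept b (cycle_choice d) | v != None].
Proof.
have le_j := ltnW j_lt; have le_kj : (k - j <= k)%N by apply: leq_subr.
move=> dC d_j; rewrite /kept /slots.
rewrite -!filter_predI.
have rP (s : seq slot) : [seq v <- s | predI (fun v => v != None)
      (fun v => v != cycle_choice d (tg v)) v] =
    [seq v <- [seq v <- s | v != None] | v != cycle_choice d (tg v)].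
  by rewrite -filter_predI; apply: eq_filter => v /=; rewrite andbC.
rewrite rP; have -> : [seq v <- flatten [seq block b x | x <- enum (vert g)] | v != None] =
  [seq r v | v <- flatten [seq block b x | x <- enum (vert g)] & v != at0 j].
  elim: (enum _) => //= x s IHs.
  rewrite !(filter_cat _ (block b x)) map_cat IHs; congr (_ ++ _); symmetry.
  exact: map_slot_cycle_block.
rewrite filter_map; apply: (congr1 (map r)); rewrite -filter_predI.
apply: eq_filter => v /=.
by rewrite ffunE slot_cycle_tag // (inj_eq perm_inj) andbC.
Qed.

(** The removed slot moves from position [j] to position [k], past [k - j] others; each of them
    changes the sign once. *)
Lemma sign_cycle_choice d : d \in choices b -> d (tag b) != at0 j ->
  sign_choice b d * (-1) ^+ index (at0 j) (kept b d) =
  (-1) ^+ (k - j) * (sign_choice b (cycle_choice d) *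
    (-1) ^+ index None (kept b (cycle_choice d))).
Proof.
have le_j := ltnW j_lt; have le_kj : (k - j <= k)%N by apply: leq_subr.
move=> dC d_j; have d'C : cycle_choice d \in choices b by rewrite cycle_choice_choices.
rewrite !index_kept ?slot_at0_tag //=; last 2 first.
- by rewrite ffunE -(slot_cycle_at j_lt) (inj_eq perm_inj) eq_sym.
- by rewrite eq_sym.
rewrite /sign_choice (bigD1 (tag b)) //= [in RHS](bigD1 (tag b)) //=.
rewrite [in RHS](eq_bigr (fun x => (-1) ^+ ps (d x))); last first.
  move=> x x_b; rewrite ffunE slot_cycle_pos // (choicesP _ _ dC).
  by rewrite (negPf x_b).
set P := \prod_(_ | _) _; rewrite ![_ * P * _]mulrAC -!exprD !mulrA -!exprD.
congr (_ * P); rewrite ffunE slot_cycle_pos // (choicesP _ _ dC) eqxx.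
rewrite slot_at0_pos // slot_pos_None.
have : ps (d (tag b)) != j.
  by apply: contraNneq d_j => e; rewrite (slot_eqE b) slot_at0_tag // (choicesP _ _ dC)
    slot_at0_pos // e !eqxx.
have : (ps (d (tag b)) < k.+1)%N.
  by rewrite -block_size_base -[X in block_size _ X](choicesP _ _ dC (tag b)) slot_pos_lt.
move: (ps _) (slot_offset _ _) => p q lt_p p_j.
apply: signr_odd_eq.
by do ![case: ifP]; lia.
Qed.

Lemma sum_slot_cycle phi : invariant phi ->
  \sum_(d in choices b | d (tag b) != at0 j)
    sign_choice b d * (-1) ^+ index (at0 j) (kept b d) *
    \sum_(s in slot_perms b | s None == slot_pred b (at0 j)) (-1) ^+ odd_perm s *
      contraction phi (incX o b s) (slot_edge (incX o b s) (at0 j)) None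
        (slot_edge (incX o b s)) [seq v <- kept b d | v != at0 j] =
  \sum_(d in choices b | d (tag b) != None)
    sign_choice b d * (-1) ^+ index None (kept b d) *
    \sum_(s in slot_perms b | s None == slot_pred b (at0 j)) (-1) ^+ odd_perm s *
      contraction phi (incZ o b s) (slot_edge (incZ o b s) None) (Some b)
        (slot_edge (incZ o b s)) [seq v <- kept b d | v != None].
Proof.
have le_j := ltnW j_lt; have le_kj : (k - j <= k)%N by apply: leq_subr.
move=> phi_inv.
rewrite [in RHS](reindex_inj (h := cycle_choice)) /=; last first.
  move=> d d' /ffunP e; apply/ffunP => x; apply: (perm_inj (s := r)).
  by have := e x; rewrite !ffunE.
apply: congr_big => // [d|d /andP[dC d_j]].
  rewrite cycle_choice_choices; congr (_ && ~~ _).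
  by rewrite ffunE -(slot_cycle_at j_lt) (inj_eq perm_inj).
rewrite sign_cycle_choice //; set A := sign_choice b (cycle_choice d) * _.
rewrite mulrAC mulrC; congr (A * _).
(* Composing the arrangement with [r] gives the sign of exponent [k - j], which cancels the one from
   [sign_cycle_choice]. *)
rewrite mulr_sumr [RHS](reindex_inj (mulIg r)) /=.
apply: congr_big => // [s|s /andP[sP /eqP sN]].
  have -> : ((s * r)%g \in slot_perms b) = (s \in slot_perms b).
    by apply/slot_permsP/slot_permsP => h u; have := h u; rewrite permM slot_cycle_tag.
  congr (_ && _); rewrite permM -[X in _ = (_ == X)](slot_cycle_pred j_gt0 j_lt).
  by rewrite (inj_eq perm_inj).
rewrite (contraction_slot_cycle o j_gt0 j_lt _ phi_inv sP sN).
rewrite map_slot_cycle_kept // odd_permM odd_slot_cycle // -/r.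
by rewrite signr_addb signr_odd mulrA; congr (_ * _); rewrite mulrC.
Qed.

End CycleSums.

(** * The boundary of the weighted sum *)

Section Boundary.
Variables (g : graph) (o : vertex_ordering g) (b : corner g).
Local Notation slot := (slot g).
Local Notation tg := (slot_tag b).
Local Notation ps := (slot_pos b).
Local Notation k := (valence (tag b)).
Local Notation at0 := (slot_at b (tag b)).
Local Notation incX := (incX o b).
Local Notation incZ := (incZ o b).

Definition tripleX (s : {perm slot}) (d : {ffun vert g -> slot}) : triple :=
  @Triple (slot_graph (incX s)) None [seq slot_edge (incX s) u | u <- kept b d].

Definition tripleZ (F : {perm slot} -> slot -> {set slot_half g})
    (s : {perm slot}) (d : {ffun vert g -> slot}) : triple :=
  @Triple (slot_graph (incZ s)) (Some b) [seq F s u | u <- kept b d].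

(* The position of the end of the loop along the k-gon; the value at [None]
   makes the weight constant across one of the two edges at the basepoint. *)
Definition weight (u : slot) : rat := if u is Some _ then (ps u)%:R else 0.

Definition not_None : pred slot := fun u => u != None.

Lemma choices_in_not_None d :
  (d \in choices_in b not_None) = (d \in choices b) && (d (tag b) != None).
Proof.
rewrite inE; case: (boolP (d \in choices b)) => //= dC.
apply/forallP/idP => [/(_ (tag b))//|d_b x].
have [->//|x_b] := eqVneq x (tag b).
by apply: contraNneq x_b => e; rewrite -(choicesP _ _ dC x) e.
Qed.

Lemma choices_in_predT d : (d \in choices_in b predT) = (d \in choices b).
Proof. by rewrite inE; case: (d \in choices b) => //; apply/forallP. Qed.

Hypothesis valence_ge3 : forall x : vert g, (3 <= valence x)%N.

Lemma slot_pred_neq u : u != slot_pred b u.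
Proof.
rewrite (slot_eqE b) slot_tag_pred eqxx /= slot_pos_pred /block_size.
by have := valence_ge3 (tg u); have := slot_pos_lt b u; rewrite /block_size; case: ifP; lia.
Qed.

Lemma corner_pred_neq (c : corner g) : Some c != Some (corner_pred c).
Proof.
rewrite (slot_eqE b) eqxx /= slot_pos_corner_pred.
by have := valence_ge3 (tag c); have := slot_pos_Some_lt b c; case: ifP; lia.
Qed.

Lemma slot_pred_inj : injective (slot_pred b).
Proof.
move=> u v e; have t : tg u = tg v by rewrite -(slot_tag_pred b u) e slot_tag_pred.
apply: (slot_pos_inj t); have := congr1 ps e; rewrite !slot_pos_pred t.
have := slot_pos_lt b u; have := slot_pos_lt b v; rewrite t.
by do ![case: ifP]; lia.
Qed.

Section Functional.
Variables (phi : triple -> rat) (phi_inv : invariant phi).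

Definition contractX s u M : rat :=
  contraction phi (incX s) (slot_edge (incX s) u) None (slot_edge (incX s)) M.

Definition contractZ s M : rat :=
  contraction phi (incZ s) (slot_edge (incZ s) None) (Some b) (slot_edge (incZ s)) M.

Lemma eval_bd_kept (G : graph) (x : vert G) (f : slot -> {set half G}) d :
  eval phi (bd_triple (Triple x [seq f u | u <- kept b d])) =
  \sum_(u | u != d (tg u)) (-1) ^+ index u (kept b d) *
    (phi (Triple (contract_vert (f u) x)
       [seq contract_edge (f u) (f v) | v <- kept b d & v != u]) -
     phi (Triple x [seq f v | v <- kept b d & v != u])).
Proof.
rewrite eval_bd_triple ?kept_uniq // big_seq_uniq ?kept_uniq //.
by apply: eq_bigl => u; rewrite mem_kept.
Qed.

Lemma sum_bd_tripleX :
  \sum_(s in slot_perms b) \sum_(d in choices b)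
    (-1) ^+ odd_perm s * sign_choice b d * weight (s None) *
      eval phi (bd_triple (tripleX s d)) =
  \sum_u (weight (slot_pred b u) - weight u) *
    \sum_(d in choices b | d (tg u) != u)
      sign_choice b d * (-1) ^+ index u (kept b d) *
      \sum_(s in slot_perms b | s None == slot_pred b u) (-1) ^+ odd_perm s *
        contractX s u [seq v <- kept b d | v != u].
Proof.
transitivity (\sum_(s in slot_perms b) \sum_(d in choices b) \sum_(u | u != d (tg u))
    (-1) ^+ odd_perm s * weight (s None) *
    (sign_choice b d * (-1) ^+ index u (kept b d) *
     contractX s u [seq v <- kept b d | v != u])).
  (* For a fixed arrangement the two sides differ by removal terms, whose signed sum over the
     deleted edges vanishes. *)
  apply: eq_bigr => s sP; apply/eqP; rewrite -subr_eq0 -sumrB; apply/eqP.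
  have := @sum_removals0 _ b predT (fun M => phi (@Triple (slot_graph (incX s)) None
    [seq slot_edge (incX s) u | u <- M])).
  under eq_bigl do rewrite choices_in_predT.
  move/(congr1 ( *%R (- ((-1) ^+ odd_perm s * weight (s None))))); rewrite mulr0 => E.
  rewrite -[RHS]E mulr_sumr; apply: eq_bigr => d dC.
  rewrite eval_bd_kept mulr_sumr -sumrB mulr_sumr; apply: eq_bigr => u _.
  rewrite -[phi (Triple (contract_vert _ _) _)]/(contractX s u [seq v <- kept b d | v != u]).
  move: (contractX _ _ _) (phi _) (_ ^+ odd_perm s) (weight _) (sign_choice b d) (_ ^+ index _ _).
  by move=> x1 x2 x3 x4 x5 x6; ring.
rewrite exchange_big /=.
under eq_bigr do rewrite exchange_big /=.
rewrite (exchange_big_dep predT) //=; apply: eq_bigr => u _.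
rewrite mulr_sumr; apply: congr_big => // [d|d /andP[dC d_u]].
  by rewrite eq_sym.
set A := sign_choice b d * _.
under eq_bigr do rewrite mulrCA.
rewrite -mulr_sumr mulrCA; congr (A * _).
apply: (@sum_swap _ b u (slot_pred b u) weight
  (fun s => contractX s u [seq v <- kept b d | v != u])).
- exact: slot_pred_neq.
- by rewrite slot_tag_pred.
by move=> s _; apply: contractionX_tperm.
Qed.

(** Removals of labels other than [None] cancel in pairs, and so do contractions of polygon edges.
    The removal of [None] has no partner, since [None] is never the deleted slot. *)
Lemma sum_bd_tripleZ (F : {perm slot} -> slot -> {set slot_half g}) :
  (forall s c, F s (Some c) = slot_edge (incZ s) (Some c)) ->
  (forall s t, F s = F t) ->
  \sum_(s in slot_perms b | s None != None) \sum_(d in choices_in b not_None)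
    (-1) ^+ odd_perm s * sign_choice b d * eval phi (bd_triple (tripleZ F s d)) =
  \sum_(d in choices_in b not_None)
    sign_choice b d * (-1) ^+ index None (kept b d) *
    (\sum_(s in slot_perms b | s None != None) (-1) ^+ odd_perm s *
       (contraction phi (incZ s) (F s None) (Some b) (F s)
          [seq v <- kept b d | v != None] -
        phi (@Triple (slot_graph (incZ s)) (Some b)
          [seq slot_edge (incZ s) v | v <- kept b d & v != None]))).
Proof.
move=> F_Some F_const.
pose C s u M := contraction phi (incZ s) (F s u) (Some b) (F s) M.
pose R s M := phi (@Triple (slot_graph (incZ s)) (Some b) [seq F s v | v <- M]).
have C_Some0 d c : \sum_(s in slot_perms b | s None != None)
    (-1) ^+ odd_perm s * C s (Some c) [seq v <- kept b d | v != Some c] = 0.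
  (* The restriction on [s None] is encoded as a weight; it equals 1 at both corners, so its jump is
     zero. *)
  have := @sum_swap _ b (Some c) (Some (corner_pred c)) (fun u => (u != None)%:R)
    (fun s => C s (Some c) [seq v <- kept b d | v != Some c]) (corner_pred_neq c).
  rewrite /= subrr mul0r => E; rewrite -{}[RHS]E //; last first.
    move=> s _; rewrite /C (F_const _ s) F_Some.
    exact: contractionZ_tperm.
  rewrite big_mkcondr; apply: eq_bigr => s _.
  by case: (s None != None); rewrite ?mulr1 // mulr0 mul0r.
have R_Some0 s : \sum_(d in choices_in b not_None)
    \sum_(u | (u != None) && (u != d (tg u)))
     sign_choice b d * (-1) ^+ index u (kept b d) * R s [seq v <- kept b d | v != u] = 0.
  exact: (@sum_removals0 _ b not_None (R s)).
transitivity (\sum_(s in slot_perms b | s None != None)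
    \sum_(d in choices_in b not_None) \sum_(u | u != d (tg u))
    (-1) ^+ odd_perm s * (sign_choice b d * (-1) ^+ index u (kept b d) *
      (C s u [seq v <- kept b d | v != u] - R s [seq v <- kept b d | v != u]))).
  apply: eq_bigr => s _; apply: eq_bigr => d dC.
  by rewrite eval_bd_kept mulr_sumr; apply: eq_bigr => u _; rewrite !mulrA.
have d_None d : d \in choices_in b not_None -> None != d (tg None).
  by rewrite choices_in_not_None eq_sym => /andP[].
transitivity (\sum_(s in slot_perms b | s None != None) (-1) ^+ odd_perm s *
   (\sum_(d in choices_in b not_None)
      sign_choice b d * (-1) ^+ index None (kept b d) *
      (C s None [seq v <- kept b d | v != None] - R s [seq v <- kept b d | v != None])
   + \sum_(d in choices_in b not_None) \sum_(u | (u != None) && (u != d (tg u)))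
      sign_choice b d * (-1) ^+ index u (kept b d) *
      C s u [seq v <- kept b d | v != u])).
  apply: eq_bigr => s _; rewrite -[X in _ * (_ + X)]subr0 -{}[X in _ - X](R_Some0 s).
  rewrite -sumrB -big_split /= mulr_sumr; apply: eq_bigr => d dC.
  rewrite (bigD1 None) ?d_None //= [RHS]mulrDr -sumrB mulr_sumr.
  congr (_ + _); apply: congr_big => // [u|u _]; first by rewrite andbC.
  by rewrite mulrBr.
under eq_bigr do rewrite mulrDr.
rewrite big_split /= [X in _ + X](_ : _ = 0) ?addr0; last first.
  under eq_bigr do rewrite mulr_sumr.
  rewrite exchange_big /= big1 // => d dC.
  under eq_bigr do rewrite mulr_sumr.
  rewrite exchange_big /= big1 // => -[c|] //= _.
  under eq_bigr do rewrite mulrCA.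
  by rewrite -mulr_sumr C_Some0 mulr0.
under eq_bigr do rewrite mulr_sumr.
rewrite exchange_big /=; apply: eq_bigr => d dC.
rewrite mulr_sumr; apply: eq_bigr => s _; rewrite mulrCA; congr (_ * (_ * (_ - phi (Triple _ _)))).
(* Once [None] is removed only labels [Some c] remain, on which [F] is [slot_edge]. *)
by apply/eq_in_map => -[c|]; rewrite mem_filter //=.
Qed.

(* The slots off the basepoint whose edge does not end there either. *)
Definition inner_slot : pred slot :=
  fun u => [&& tg u == tag b, slot_pred b u != None & u != None].

Definition sumZ (u : slot) : rat :=
  \sum_(d in choices b | d (tag b) != None)
    sign_choice b d * (-1) ^+ index None (kept b d) *
    \sum_(s in slot_perms b | s None == slot_pred b u) (-1) ^+ odd_perm s *
      contractZ s [seq v <- kept b d | v != None].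

(** The jump of the weight is [k - 1] on the edge of [None], 0 on the edge starting at [None] and -1
    on the inner edges. Other polygons give nothing, because the loop end stays in the polygon at
    [tag b]. *)
Lemma sum_bd_tripleX_inner :
  \sum_(s in slot_perms b) \sum_(d in choices b)
    (-1) ^+ odd_perm s * sign_choice b d * weight (s None) *
      eval phi (bd_triple (tripleX s d)) =
  k.-1%:R * (\sum_(d in choices b | d (tag b) != None)
    sign_choice b d * (-1) ^+ index None (kept b d) *
    \sum_(s in slot_perms b | s None == Some b) (-1) ^+ odd_perm s *
      contractX s None [seq v <- kept b d | v != None]) -
  \sum_(u | inner_slot u) sumZ u.
Proof.
rewrite sum_bd_tripleX (bigD1 None) //= subr0.
rewrite -slot_pos_base /=; congr (_ + _).
rewrite -sumrN big_mkcond [RHS]big_mkcond; apply: eq_bigr => u _.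
rewrite /inner_slot andbA andbC; case: (u =P None) => [//|/eqP u_None] /=.
case: (tg u =P tag b) => [tu|/eqP tu] /=; last first.
  rewrite [X in _ * X]big1 ?mulr0 // => d _.
  rewrite [X in _ * X]big_pred0 ?mulr0 // => s.
  apply/negP => /andP[/slot_permsP sP /eqP sN]; case/eqP: tu.
  by rewrite -(slot_tag_pred b) -sN sP.
case: (slot_pred b u =P None) => [pu|/eqP pu] /=.
  have /eqP pu0 : ps u == 0%N.
    have := congr1 ps pu; rewrite slot_pos_pred slot_pos_None tu block_size_base.
    by have := slot_pos_lt b u; rewrite tu block_size_base; case: ifP; lia.
  have -> : weight (slot_pred b u) - weight u = 0; last by rewrite mul0r.
  by rewrite pu /weight; case: u {tu pu u_None} pu0 => [c|] /= => [->|]; rewrite subrr.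
have pos_u : (0 < ps u < k)%N.
  have pk : ps u != k by apply: contra u_None => /eqP e; apply/eqP/(slot_NoneP b); rewrite tu e !eqxx.
  have := slot_pos_lt b u; rewrite tu block_size_base.
  suff : ps u != 0%N by lia.
  apply: contra pu => /eqP e; apply/eqP/(slot_NoneP b).
  by rewrite slot_tag_pred slot_pos_pred tu eqxx e block_size_base /= eqxx.
have u_at : at0 (ps u) = u by rewrite -tu slot_at_pos.
have -> : weight (slot_pred b u) - weight u = -1.
  have := slot_pos_pred b u; case: (slot_pred b u) pu => // c' _.
  case: (u) pos_u u_None => // c pos_c _ e; rewrite /weight {}e.
  rewrite ifN; last by case/andP: pos_c; case: (ps _).
  by case/andP: pos_c; case: (ps _) => // p _ _; rewrite -natr1 /=; ring.
case/andP: pos_u => pos_gt0 pos_lt; rewrite mulN1r; congr (- _).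
by have := sum_slot_cycle o pos_gt0 pos_lt phi_inv; rewrite u_at tu.
Qed.

(** The removals of [None] agree for the two forests. Contractions of the half at the basepoint pair
    off under the transposition of [None] and [Some b], except when [s None = Some b], whose partner
    is excluded from the sum. By the symmetry of the halves, these leftovers subtract the terms with
    [s None = Some b] of the other copy. *)
Lemma sum_bd_tripleZ_inner :
  \sum_(s in slot_perms b | s None != None) \sum_(d in choices_in b not_None)
    (-1) ^+ odd_perm s * sign_choice b d *
      (eval phi (bd_triple (tripleZ (fun s => slot_edge (incZ s)) s d)) -
       eval phi (bd_triple (tripleZ (fun s => labelZ (incZ s)) s d))) =
  \sum_(u | inner_slot u) sumZ u.
Proof.
under eq_bigr do under eq_bigr do rewrite mulrBr.
under eq_bigr do rewrite sumrB.
rewrite sumrB !sum_bd_tripleZ // -sumrB /sumZ exchange_big /=.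
apply: congr_big => // [d|d dC]; first exact: choices_in_not_None.
rewrite -mulrBr -mulr_sumr; congr (_ * _); rewrite -sumrB.
set M := [seq v <- kept b d | v != None].
transitivity (\sum_(s in slot_perms b | s None != None) (-1) ^+ odd_perm s * contractZ s M -
   \sum_(s in slot_perms b | s None != None) (-1) ^+ odd_perm s *
     contraction phi (incZ s) (loop_edge (incZ s)) (Some b) (labelZ (incZ s)) M).
  rewrite -sumrB; apply: eq_bigr => s _; rewrite -!mulrBr; congr (_ * _).
  rewrite opprB addrA subrK; congr (_ - _).
have -> : \sum_(s in slot_perms b | s None != None) (-1) ^+ odd_perm s *
     contraction phi (incZ s) (loop_edge (incZ s)) (Some b) (labelZ (incZ s)) M =
   \sum_(s in slot_perms b | s None == Some b) (-1) ^+ odd_perm s * contractZ s M.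
  have := @sum_swap _ b None (Some b) (fun u => (u != None)%:R)
    (fun s => contraction phi (incZ s) (loop_edge (incZ s)) (Some b) (labelZ (incZ s)) M).
  rewrite /= subr0 mul1r => E.
  transitivity (\sum_(s in slot_perms b | s None == Some b) (-1) ^+ odd_perm s *
     contraction phi (incZ s) (loop_edge (incZ s)) (Some b) (labelZ (incZ s)) M).
    rewrite -E //; last by move=> s _; apply: contractionZ_loop_tperm.
    rewrite big_mkcondr; apply: eq_bigr => s _.
    by case: (s None != None); rewrite ?mulr1 // mulr0 mul0r.
  by apply: eq_bigr => s /andP[_ /eqP sN]; rewrite -contractionZ_swap_loop.
rewrite (bigID (fun s : {perm slot} => s None == Some b)) /= addrC.
rewrite [X in _ + X - _](eq_bigl (fun s => (s \in slot_perms b) && (s None == Some b)));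
  last first.
  by move=> s; rewrite -andbA; case: eqP => [->|]; rewrite ?andbF.
rewrite addrK (partition_big (fun s : {perm slot} => s None)
  (fun u => [&& tg u == tag b, u != None & u != Some b])) /=; last first.
  by move=> s /andP[/andP[/slot_permsP sP ->] ->]; rewrite sP eqxx.
(* The place of the loop end is written as [slot_pred b u]: it differs from [Some b] exactly when
   [u] differs from [None]. *)
rewrite (reindex_inj slot_pred_inj) /=; apply: congr_big => // [u|u /and3P[tu pu_None pu_b]].
  rewrite /inner_slot slot_tag_pred; congr [&& _, _ & ~~ _].
  by rewrite -[Some b]/(slot_pred b None) (inj_eq slot_pred_inj).
apply: eq_bigl => s; rewrite -!andbA; congr (_ && _).
by case: (s None =P slot_pred b u) => [->|]; rewrite ?andbF // pu_None pu_b.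
Qed.

(** A last transposition, along the edge of [None], moves the loop end from [Some b] to the
    basepoint. This costs the minus sign and makes the loop a loop at the basepoint. *)
Lemma sum_bd_total :
  \sum_(s in slot_perms b) \sum_(d in choices b)
    (-1) ^+ odd_perm s * sign_choice b d * weight (s None) *
      eval phi (bd_triple (tripleX s d)) +
  \sum_(s in slot_perms b | s None != None) \sum_(d in choices_in b not_None)
    (-1) ^+ odd_perm s * sign_choice b d *
      (eval phi (bd_triple (tripleZ (fun s => slot_edge (incZ s)) s d)) -
       eval phi (bd_triple (tripleZ (fun s => labelZ (incZ s)) s d))) =
  - k.-1%:R * (\sum_(d in choices b | d (tag b) != None)
    sign_choice b d * (-1) ^+ index None (kept b d) *
    \sum_(s in slot_perms b | s None == None) (-1) ^+ odd_perm s *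
      contractX s None [seq v <- kept b d | v != None]).
Proof.
rewrite sum_bd_tripleX_inner sum_bd_tripleZ_inner subrK mulNr -mulrN -sumrN.
congr (_ * _); apply: eq_bigr => d _; rewrite -mulrN; congr (_ * _).
have := @sum_swap _ b (Some b) None (fun u => (u == Some b)%:R)
    (fun s => contractX s None [seq v <- kept b d | v != None]).
rewrite /= eqxx sub0r mulN1r => <- //; last first.
  move=> s _; rewrite tpermC; exact: contractionX_tperm.
rewrite big_mkcondr; apply: eq_bigr => s _.
by case: (s None == Some b); rewrite ?mulr1 // mulr0 mul0r.
Qed.

End Functional.
End Boundary.

(** * Comparison with the stabilized cycle *)

Section PermExtension.
Variables (A B : finType) (f : A -> B) (f_inj : injective f).

Definition ext_fun (p : {perm A}) (y : B) : B :=
  if [pick x | f x == y] is Some x then f (p x) else y.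

Lemma ext_fun_im p x : ext_fun p (f x) = f (p x).
Proof.
rewrite /ext_fun; case: pickP => [x' /eqP/f_inj ->//|/(_ x)].
by rewrite eqxx.
Qed.

Lemma ext_fun_out p y : (forall x, f x != y) -> ext_fun p y = y.
Proof. by move=> out; rewrite /ext_fun; case: pickP => // x; rewrite (negPf (out x)). Qed.

Lemma im_or_out y : (exists x, y = f x) \/ (forall x, f x != y).
Proof.
case: (pickP (fun x => f x == y)) => [x /eqP <-|out]; first by left; exists x.
by right=> x; rewrite out.
Qed.

Lemma ext_fun_inj p : injective (ext_fun p).
Proof.
move=> y z; case: (im_or_out y) => [[x ->]|oy]; case: (im_or_out z) => [[x' ->]|oz];
  rewrite ?ext_fun_im ?ext_fun_out //.
- by move/f_inj/perm_inj ->.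
- by move=> e; case/eqP: (oz (p x)).
by move=> e; case/eqP: (oy (p x')).
Qed.

Definition ext_perm (p : {perm A}) : {perm B} := perm (@ext_fun_inj p).

Lemma ext_perm_im p x : ext_perm p (f x) = f (p x).
Proof. by rewrite permE ext_fun_im. Qed.

Lemma ext_perm_out p y : (forall x, f x != y) -> ext_perm p y = y.
Proof. by move=> out; rewrite permE ext_fun_out. Qed.

Lemma ext_permM p q : ext_perm (p * q)%g = (ext_perm p * ext_perm q)%g.
Proof.
apply/permP=> y; rewrite permM; case: (im_or_out y) => [[x ->]|out].
  by rewrite !ext_perm_im permM.
by rewrite !ext_perm_out.
Qed.

Lemma ext_perm_tperm x x' : ext_perm (tperm x x') = tperm (f x) (f x').
Proof.
apply/permP=> y; case: (im_or_out y) => [[z ->]|out].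
  by rewrite ext_perm_im (inj_tperm _ _ _ f_inj).
by rewrite ext_perm_out // tpermD.
Qed.

(** A product of transpositions extends to a product of equally many transpositions. *)
Lemma odd_ext_perm p : odd_perm (ext_perm p) = odd_perm p.
Proof.
have [ts -> _] := prod_tpermP p.
elim: ts => [|[x x'] ts IHts].
  rewrite !big_nil odd_perm1 -(odd_perm1 B); congr odd_perm.
  apply/permP=> y; rewrite perm1; case: (im_or_out y) => [[z ->]|out].
    by rewrite ext_perm_im perm1.
  exact: ext_perm_out.
rewrite !big_cons ext_permM !odd_permM IHts ext_perm_tperm !odd_tperm.
by rewrite (inj_eq f_inj).
Qed.

End PermExtension.

Section Stabilization.
Variables (g : graph) (o : vertex_ordering g) (b : corner g).
Local Notation slot := (slot g).
Local Notation tg := (slot_tag b).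
Local Notation ps := (slot_pos b).
Local Notation k := (valence (tag b)).
Local Notation incX := (incX o b).

Definition to_corner (x : vert g) (i : 'I_(valence x)) : corner g :=
  Tagged (fun x => 'I_(valence x)) i.

Definition to_slot (x : vert g) (i : 'I_(valence x)) : slot := Some (to_corner i).

Lemma to_corner_inj x : injective (@to_corner x).
Proof. by move=> i j /eqP; rewrite -tag_eqE /tag_eq eqxx tagged_asE /= => /eqP. Qed.

Lemma to_slot_inj x : injective (@to_slot x).
Proof. by move=> i j [] /to_corner_inj. Qed.

Lemma to_corner_tagged (c : corner g) : to_corner (tagged c) = c.
Proof. by case: c. Qed.

Definition perm_of (s : permutations_at g) : {perm slot} :=
  (\prod_(x <- enum (vert g)) ext_perm (@to_slot_inj x) (s x))%g.

Lemma perm_of_prod (s : permutations_at g) (r : seq (vert g)) (u : slot) : uniq r ->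
  (\prod_(x <- r) ext_perm (@to_slot_inj x) (s x))%g u =
  if u is Some c then
    if tag c \in r then to_slot (s (tag c) (tagged c)) else u
  else u.
Proof.
elim: r u => [|x r IHr] u /=; first by rewrite big_nil perm1; case: u.
case/andP=> x_r r_uniq; rewrite big_cons permM IHr //.
case: u => [c|]; last by rewrite ext_perm_out.
rewrite inE; case: (tag c =P x) => [e|ne] /=.
  case: c e => y i /= e; subst y.
  by rewrite -[Some _]/(to_slot i) ext_perm_im /= (negPf x_r).
by rewrite ext_perm_out // => i; apply/eqP => -[e]; case: ne; rewrite -e.
Qed.

Lemma perm_of_Some s c : perm_of s (Some c) = to_slot (s (tag c) (tagged c)).
Proof. by rewrite /perm_of perm_of_prod ?enum_uniq // mem_enum. Qed.

Lemma perm_of_None s : perm_of s None = None.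
Proof. by rewrite /perm_of perm_of_prod ?enum_uniq. Qed.

Lemma sign_perm_of s : (-1) ^+ odd_perm (perm_of s) = sign_perms s.
Proof.
rewrite /perm_of /sign_perms -big_enum.
elim: (enum _) => [|x r IHr]; first by rewrite !big_nil odd_perm1.
by rewrite !big_cons odd_permM odd_ext_perm signr_addb IHr.
Qed.

Lemma perm_of_inj : injective perm_of.
Proof.
move=> s s' e; apply/ffunP=> x; apply/permP=> i; apply: (@to_slot_inj x).
by have := perm_of_Some s (to_corner i); rewrite e perm_of_Some.
Qed.

Lemma perm_of_im (s : {perm slot}) : s \in slot_perms b -> s None = None ->
  exists s', s = perm_of s'.
Proof.
move=> /slot_permsP sP sN.
pose f x (i : 'I_(valence x)) : 'I_(valence x) :=
  if s (to_slot i) is Some c then tagged_as (to_corner i) c else i.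
have fE x (i : 'I_(valence x)) : to_slot (f x i) = s (to_slot i).
  rewrite /f; case e : (s (to_slot i)) => [c|]; last first.
    by have /perm_inj : s (to_slot i) = s None by rewrite e sN.
  have tc : tag c = x by have := sP (to_slot i); rewrite e.
  by case: c e tc => y j /= e tc; subst y; rewrite tagged_asE.
have f_inj x : injective (f x).
  by move=> i j /(congr1 (@to_slot x)); rewrite !fE => /perm_inj/to_slot_inj.
exists [ffun x => perm (f_inj x)]; apply/permP => -[c|]; last by rewrite perm_of_None.
by rewrite perm_of_Some ffunE permE fE /to_slot to_corner_tagged.
Qed.

Definition choice_of (d : deletions g) : {ffun vert g -> slot} :=
  [ffun x => to_slot (d x)].

Lemma choice_of_inj : injective choice_of.
Proof.
move=> d d' /ffunP e; apply/ffunP=> x; apply: (@to_slot_inj x).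
by have := e x; rewrite !ffunE.
Qed.

Lemma choice_of_im d : d \in choices_in b (@not_None g) -> exists d', d = choice_of d'.
Proof.
case/andP=> /choicesP dC /forallP d_N.
have f x : {i : 'I_(valence x) | to_slot i == d x}.
  have := dC x; have := d_N x; case: (d x) => [c|] //= _ tc.
  by subst x; exists (tagged c); rewrite /to_slot to_corner_tagged.
exists [ffun x => val (f x)]; apply/ffunP=> x; rewrite !ffunE.
by apply/esym/eqP; apply: (valP (f x)).
Qed.

Lemma sum_choice_of (F : {ffun vert g -> slot} -> rat) :
  \sum_(d in choices b | d (tag b) != None) F d = \sum_(d : deletions g) F (choice_of d).
Proof.
transitivity (\sum_(d in [set choice_of d | d in [set: deletions g]]) F d).
  apply: eq_bigl => d; rewrite -choices_in_not_None.
  apply/idP/imsetP => [/choice_of_im[d' ->]|[d' _ ->]]; first by exists d'.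
  rewrite choices_in_not_None ffunE andbT; apply/choicesP => x.
  by rewrite ffunE.
rewrite big_imset /=; last by move=> d d' _ _; apply: choice_of_inj.
by apply: eq_bigl => d; rewrite inE.
Qed.

Lemma sum_perm_of (F : {perm slot} -> rat) :
  \sum_(s in slot_perms b | s None == None) F s = \sum_(s : permutations_at g) F (perm_of s).
Proof.
transitivity (\sum_(s in [set perm_of s | s in [set: permutations_at g]]) F s).
  apply: eq_bigl => s.
  apply/andP/imsetP => [[sP /eqP /perm_of_im[]// s' ->]|[s' _ ->]].
    by exists s'.
  rewrite perm_of_None; split=> //; apply/slot_permsP => -[c|].
    by rewrite perm_of_Some.
  by rewrite perm_of_None.
rewrite big_imset /=; last by move=> s s' _ _; apply: perm_of_inj.
by apply: eq_bigl => s; rewrite inE.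
Qed.

(** The corners in the order of [block], which at [tag b] is a rotation of the order used by
    [maximal_forest]. *)
Definition rotated_corners : seq (corner g) :=
  flatten [seq [seq to_corner i | i <- rot (slot_shift b x) (enum 'I_(valence x))]
             | x <- enum (vert g)].

Lemma kept_choice_of d : [seq v <- kept b (choice_of d) | v != None] =
  [seq Some c | c : corner g <- rotated_corners & tagged c != d (tag c)].
Proof.
rewrite /kept /slots /rotated_corners; elim: (enum (vert g)) => //= x r IHr.
rewrite (filter_cat _ (block b x)) [LHS]filter_cat [in RHS]filter_cat map_cat -IHr.
congr (_ ++ _).
rewrite /block !filter_cat.
rewrite [X in _ ++ X](_ : _ = [::]) ?cats0; last by case: (x == tag b) => //=; case: ifP.
elim: (rot _ _) => //= i l IHl; rewrite ffunE /=.
have -> : (Some (Tagged (fun x => 'I_(valence x)) i) != to_slot (d x)) = (i != d x).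
  by rewrite -[Some _]/(to_slot i) (inj_eq (@to_slot_inj x)).
by case: ifP => //= _; rewrite IHl.
Qed.

Hypothesis valence_odd : forall x : vert g, odd (valence x).

Definition rotated_sign (d : deletions g) : nat :=
  ((tagged b).+1 - (d (tag b) < (tagged b).+1))%N.

Lemma size_filter_enum_take n m (j : 'I_n) : (m <= n)%N ->
  size [seq i <- take m (enum 'I_n) | i != j] = (m - (j < m))%N.
Proof.
move=> le_m; have sz : size (take m (enum 'I_n)) = m.
  by rewrite size_takel // size_enum_ord.
have j_in : (j \in take m (enum 'I_n)) = (j < m)%N.
  have u := enum_uniq 'I_n; rewrite in_take ?size_enum_ord ?mem_enum //.
  by rewrite index_enum_ord.
case: ltnP j_in => [lt_jm|le_mj] j_in.
  by rewrite size_filter_neq ?take_uniq ?enum_uniq ?sz ?subn1.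
rewrite subn0 -[RHS]sz; congr size; apply/all_filterP/allP => i.
by apply: contraTneq => ->; rewrite j_in.
Qed.

Lemma size_filter_enum_drop n m (j : 'I_n) : (m <= n)%N ->
  size [seq i <- drop m (enum 'I_n) | i != j] = (n - m - (m <= j))%N.
Proof.
move=> le_m.
have : (m - (j < m) + size [seq i <- drop m (enum 'I_n) | i != j] = n.-1)%N.
  rewrite -size_filter_enum_take // -size_cat -filter_cat cat_take_drop.
  by rewrite size_filter_neq ?enum_uniq ?mem_enum ?size_enum_ord.
by move: (size _) (ltn_ord j) => p; case: (ltnP j m) => /=; lia.
Qed.

(** Undoing the rotation moves p kept edges past q others. As [p + q = k - 1] is even, the product
    of p and q has the parity of p, which is [rotated_sign d] when p counts the kept edges up to
    that of [b]. *)
Lemma invariant_rotated_corners phi (G : graph) (x : vert G)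
    (F : corner g -> {set half G}) (d : deletions g) : invariant phi ->
  phi (Triple x [seq F c | c : corner g <- rotated_corners & tagged c != d (tag c)]) =
  (-1) ^+ rotated_sign d *
  phi (Triple x [seq F c | c : corner g <- [seq Tagged (fun x => 'I_(valence x)) i
     | x <- enum (vert g), i <- enum 'I_(valence x)] & tagged c != d (tag c)]).
Proof.
move=> phi_inv; rewrite /rotated_corners.
have : tag b \in enum (vert g) by rewrite mem_enum.
have := enum_uniq (vert g); set r := enum (vert g) => r_uniq b_r.
case/splitPr: b_r r_uniq => r1 r2; rewrite cat_uniq /= => /and4P[_ /norP[b_r1 _] b_r2 _].
have unrot (s : seq (vert g)) : tag b \notin s ->
    flatten [seq [seq to_corner i | i <- rot (slot_shift b x) (enum 'I_(valence x))]
             | x <- s] =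
    flatten [seq [seq to_corner i | i <- enum 'I_(valence x)] | x <- s].
  move=> b_s; congr flatten; apply/eq_in_map => y ys; rewrite /slot_shift ifN ?rot0 //.
  by apply: contraNneq b_s => <-.
rewrite !map_cat !flatten_cat /= !unrot // !filter_cat !map_cat.
rewrite /slot_shift eqxx filter_cat map_cat -!catA.
rewrite (invariant_rot phi_inv); congr (_ * _); last first.
  congr (phi (Triple _ (_ ++ _))).
  rewrite -[X in _ = [seq F i | i <- [seq c <- [seq _ | i <- X] | _]] ++ _]
    (cat_take_drop (tagged b).+1).
  by rewrite map_cat filter_cat map_cat catA.
have sz (s : seq 'I_k) :
    size [seq F c | c : corner g <- [seq to_corner i | i <- s] & tagged c != d (tag c)] =
    size [seq i <- s | i != d (tag b)].
  by rewrite size_map filter_map size_map.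
rewrite !sz size_filter_enum_take ?size_filter_enum_drop //.
apply: signr_odd_eq; rewrite /rotated_sign.
have := ltn_ord (tagged b); have := valence_odd (tag b).
have := ltn_ord (d (tag b)).
by rewrite oddM; case: (ltnP (d (tag b)) (tagged b).+1) => /=; lia.
Qed.

(** Each vertex contributes a sign because [sign_forest] counts edges from 1. At [tag b] the slot
    position is shifted cyclically, and [rotated_sign] with the oddness of [k] compensates for
    this. *)
Lemma sign_choice_of d :
  sign_choice b (choice_of d) * (-1) ^+ rotated_sign d =
  (-1) ^+ #|vert g| * sign_forest d.
Proof.
have -> : (-1) ^+ #|vert g| = \prod_(x : vert g) (-1) :> rat.
  by rewrite prodr_const.
rewrite /sign_forest -big_split /= /sign_choice (bigD1 (tag b)) //=.
rewrite [RHS](bigD1 (tag b)) //= mulrAC; congr (_ * _).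
  rewrite -exprS -exprD ffunE slot_pos_Some /slot_shift /= eqxx /rotated_sign.
  have := valence_odd (tag b); have := ltn_ord (tagged b); have := ltn_ord (d (tag b)).
  by move=> lt_d lt_b odd_k; apply: signr_odd_eq; case: ifP; lia.
apply: eq_bigr => x x_b; rewrite -exprS ffunE slot_pos_Some /slot_shift /= (negPf x_b).
by rewrite ltn0 subn0; apply: signr_odd_eq; rewrite /= negbK.
Qed.

(** The polygons listed earlier contribute even numbers of kept edges, and within its own block
    [None] follows [k - 1] kept ones. *)
Lemma index_None_kept d : d \in choices b -> d (tag b) != None ->
  (-1) ^+ index None (kept b d) = 1 :> rat.
Proof.
move=> dC d_b; rewrite index_kept //= 1?eq_sym // slot_pos_None.
rewrite -[RHS](expr0 (-1)); apply: signr_odd_eq.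
have -> : (ps (d (tag b)) < k)%N.
  have := choicesP _ _ dC (tag b).
  by case: (d (tag b)) d_b => //= c _ <-; apply: slot_pos_Some_lt.
have odd_k := valence_odd (tag b).
suff : ~~ odd (slot_offset b (tag b)) by lia.
rewrite /slot_offset; have := enum_uniq (vert g).
have : tag b \in enum (vert g) by rewrite mem_enum.
case/splitPr => r1 r2; rewrite cat_uniq /= => /and3P[_ /norP[b_r1 _] _].
rewrite index_cat (negPf b_r1) /= eqxx addn0 take_size_cat //.
elim: r1 b_r1 => [|x r1 IHr]; first by rewrite big_nil.
rewrite inE negb_or big_cons => /andP[x_b /IHr].
rewrite {2}/block_size [x == _]eq_sym (negPf x_b) addn0.
by have := valence_odd x; move: (valence x) (bigop _ _ _) => n m; lia.
Qed.

(** Contracting the edge from [b] to [None] restores the k-gon with basepoint [b]. Since [perm_of s]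
    fixes [None], both ends of the loop lie there. *)
Lemma contractX_stab phi s (d : deletions g) : invariant phi ->
  contractX o b phi (perm_of s) None [seq v <- kept b (choice_of d) | v != None] =
  (-1) ^+ rotated_sign d *
  phi (stab_triple (@Triple (polygon_graph o s) b (maximal_forest o s d))).
Proof.
move=> phi_inv; rewrite /stab_triple /= /maximal_forest -map_comp.
rewrite -(invariant_rotated_corners _ _ _ phi_inv) kept_choice_of.
rewrite /contractX /contraction -map_comp; apply/esym; apply: (proj1 phi_inv).
set e := slot_edge _ _.
pose G' := @add_loop (polygon_graph o s) b.
pose f (h : half G') : slot_half g := match h with
  | inl (inl h) => inl (inl h)
  | inl (inr (c, x)) => inr (Some c, x)
  | inr x => inl (inr x)
  end.
have ends_e : ends e = [set Some b; None].
  by rewrite (@ends_edge (slot_graph _)).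
have coll : collapse e None = collapse e (Some b).
  by apply: (@collapse_ends (slot_graph (incX (perm_of s)))); rewrite ends_e !inE eqxx ?orbT.
apply: (@triple_iso_contract_section (slot_graph (incX (perm_of s))) G' e None b
  (corner g) _ (fun c => slot_edge (incX (perm_of s)) (Some c)) _ Some f).
- move=> x y /eqP/(@collapse_eqP (slot_graph _)); rewrite ends_e !inE !orbF.
  by case=> [[]//|[/eqP[->] /eqP[->]]].
- by case=> [c|]; [exists c|exists b].
- by case=> [[h|[c x]]|x] [[h'|[c' x']]|x'] //= [] => [->|-> ->|->].
- by case=> [[h|[c x]]|x]; rewrite mem_edge.
- case=> [[h|x]|[[c|] x]] h_e.
  + by exists (inl (inl h)).
  + by exists (inr x).
  + by exists (inl (inr (c, x))).
  by move: h_e; rewrite mem_edge; case: x.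
- by case=> [[h|[c x]]|x].
- case=> [[h|[c []]]|[]] //=.
  + by rewrite perm_of_Some.
  (* The edge in position 0 starts at [None] in the enlarged polygon and at [b] in the original
     one. *)
  + case: ifP => // /andP[/eqP p0 /eqP tc]; rewrite coll; congr (collapse e (Some _)).
    suff [] : Some b = Some (corner_pred c) by [].
    apply: (slot_pos_inj (b := b)); rewrite ?tc //=.
    by rewrite slot_pos_corner_pred p0 eqxx tc -slot_pos_base.
  by rewrite perm_of_None.
- by rewrite coll.
move=> c; rewrite -imset_comp /slot_edge /polygon_edge /edge.
by rewrite !imsetU1 !imset_set1.
Qed.

Lemma sum_contractX_stab phi : invariant phi ->
  \sum_(d in choices b | d (tag b) != None)
    sign_choice b d * (-1) ^+ index None (kept b d) *
    \sum_(s in slot_perms b | s None == None) (-1) ^+ odd_perm s *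
      contractX o b phi s None [seq v <- kept b d | v != None] =
  (-1) ^+ #|vert g| * eval phi (stab (zcycle o b)).
Proof.
move=> phi_inv; rewrite sum_choice_of.
rewrite /eval big_map /zcycle big_allpairs_dep /= !big_enum /= exchange_big /=.
rewrite mulr_sumr big_enum; apply: congr_big => // d _; rewrite index_None_kept ?mulr1; last 2 first.
- by apply/choicesP => x; rewrite ffunE.
- by rewrite ffunE.
rewrite sum_perm_of !mulr_sumr; apply: congr_big => // s _.
rewrite contractX_stab // sign_perm_of.
rewrite mulrCA [sign_choice _ _ * _]mulrA sign_choice_of.
by rewrite [_ * (sign_perms s * _ * _)]mulrA [_ * (sign_perms s * _)]mulrCA !mulrA.
Qed.


End Stabilization.

(** * The graphs in X and Z are generators *)

(** Every point descends to a point of height 0, and each fibre of [t] has at most one such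
    point. *)
Lemma connect_descent (V : finType) (I : eqType) (e : rel V) (t : V -> I)
    (p : V -> nat) : connect_sym e ->
  (forall u, p u != 0%N -> exists v, [/\ t v = t u, (p v < p u)%N & connect e u v]) ->
  (forall u v, t u = t v -> p u = 0%N -> p v = 0%N -> u = v) ->
  forall u v, t u = t v -> connect e u v.
Proof.
move=> e_sym descend t_inj.
have root u : exists v, [/\ t v = t u, p v = 0%N & connect e u v].
  elim: {u}(p u) {-2}u (leqnn (p u)) => [|m IHm] u le_u.
    by exists u; split=> //; apply/eqP; rewrite -leqn0.
  have [p0|pn0] := eqVneq (p u) 0%N; first by exists u.
  have [v [tv lt_v cv]] := descend u pn0.
  have [|w [tw pw cw]] := IHm v; first by rewrite -ltnS (leq_trans lt_v).
  by exists w; rewrite tw tv; split=> //; apply: connect_trans cv cw.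
move=> u v tuv; have [u' [tu' pu' cu]] := root u; have [v' [tv' pv' cv]] := root v.
have e' : u' = v' by apply: t_inj; rewrite // tu' tv'.
by apply: connect_trans cu _; rewrite e' e_sym.
Qed.

(** A path in [g] is lifted edge by edge, consecutive lifts being joined inside a fibre. *)
Lemma connected_over (g G : graph) (t : vert G -> vert g) :
  connected g ->
  (forall u v, t u = t v -> connect (@adj G) u v) ->
  (forall x, exists u, t u = x) ->
  (forall h : half g, exists u v,
     [/\ t u = inc h, t v = inc (opp h) & connect (@adj G) u v]) ->
  connected G.
Proof.
move=> [g_gt0 g_conn] fibre t_surj lift; split.
  have /card_gt0P[x _] := g_gt0; have [u _] := t_surj x.
  by apply/card_gt0P; exists u.
move=> u v; have /connectP[p] := g_conn (t u) (t v).
elim: p u => [|y p IHp] u /=; first by move=> _ e; apply: fibre.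
case/andP=> /existsP[h /andP[/eqP hu /eqP hy]] p_path e.
have [u' [v' [tu' tv' cuv]]] := lift h.
apply: (connect_trans (fibre u u' _)); first by rewrite tu'.
apply: (connect_trans cuv); apply: IHp; rewrite tv' hy //.
Qed.

Lemma betti1_half (G : graph) m n : connected G -> #|half G| = (2 * m)%N ->
  #|vert G| = n -> betti1 G = (m + 1 - n)%N.
Proof.
move=> G_conn; rewrite card_half => /eqP; rewrite eqn_pmul2l // => /eqP em en.
by rewrite betti1_connected // em en.
Qed.

Lemma is_forest_parent (G : graph) (U : eqType) (M : seq U) (c : U -> half G)
    (rank : vert G -> nat) :
  uniq M -> {in M &, injective (fun u => inc (c u))} ->
  {in M, forall u, (rank (inc (opp (c u))) < rank (inc (c u)))%N} ->
  is_forest [seq edge (c u) | u <- M].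
Proof.
move=> M_uniq c_inj c_rank.
have half_of h : edge h \in [seq edge (c u) | u <- M] ->
    exists2 u, u \in M & h = c u \/ h = opp (c u).
  by case/mapP=> u uM /eqP/edge_eqP; exists u.
apply: (is_forest_rank (rank := rank)).
- rewrite map_inj_in_uniq // => u v uM vM /eqP/edge_eqP[e|e].
    by apply: c_inj => //; rewrite e.
  have := c_rank u uM; have := c_rank v vM; rewrite e oppK => lt1 lt2.
  by have := ltn_trans lt1 lt2; rewrite ltnn.
- by move=> _ /mapP[u _ ->]; apply: imset_f.
- move=> h /half_of[u uM [->|->]]; rewrite ?oppK neq_ltn c_rank ?orbT //.
move=> h h' /half_of[u uM eh] /half_of[v vM eh'] ehh' lt1 lt2.
have {eh} eh : h = c u.
  by case: eh lt1 => // ->; rewrite oppK => /(ltn_trans (c_rank u uM)); rewrite ltnn.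
have {eh'} eh' : h' = c v.
  by case: eh' lt2 => // ->; rewrite oppK => /(ltn_trans (c_rank v vM)); rewrite ltnn.
by congr edge; rewrite eh eh'; congr c; apply: c_inj; rewrite -?eh -?eh'.
Qed.

Section Generators.
Variables (g : graph) (o : vertex_ordering g) (b : corner g).
Hypothesis g_adm : admissible g.
Local Notation slot := (slot g).
Local Notation tg := (slot_tag b).
Local Notation ps := (slot_pos b).
Local Notation k := (valence (tag b)).
Local Notation incX := (incX o b).
Local Notation incZ := (incZ o b).

Lemma admissible_odd (x : vert g) : odd (valence x).
Proof. by have [_ /(_ x)/andP[]] := g_adm. Qed.

Lemma admissible_ge3 (x : vert g) : (3 <= valence x)%N.
Proof. by have [_ /(_ x)/andP[]] := g_adm. Qed.

Lemma half_corner_bij : bijective (half_corner o).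
Proof.
apply: inj_card_bij.
  move=> h h' e; have /= e1 := congr1 (@tag _ _) e.
  apply: (pos_inj (v := o)) => //.
  have : forall c c' : corner g, c = c' -> tagged c = tagged c' :> nat by move=> c c' ->.
  by move/(_ _ _ e).
rewrite card_tagged sumnE big_map big_enum /=.
rewrite -[#|half g|]sum1_card (partition_big (fun h : half g => inc h) predT) //=.
apply: leq_sum => x _; rewrite card_ord /valence -sum1_card.
by rewrite leq_eqVlt; apply/orP; left; apply/eqP/eq_bigl => h; rewrite inE.
Qed.

Lemma half_of_corner (c : corner g) : exists h, half_corner o h = c.
Proof. by have [f _ fK] := half_corner_bij; exists (f c). Qed.

Lemma corner_pred_inj : injective (@corner_pred g).
Proof.
move=> c c' e; have t : tag c = tag c' by have := congr1 (@tag _ _) e.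
suff [] : Some c = Some c' by [].
apply: (slot_pos_inj (b := b)) => //.
have := congr1 (fun c => ps (Some c)) e; rewrite /= !slot_pos_corner_pred t.
have := slot_pos_Some_lt b c; have := slot_pos_Some_lt b c'; rewrite t.
by do ![case: ifP]; lia.
Qed.

Lemma corner_pred_surj (c : corner g) : exists c', corner_pred c' = c.
Proof. by exists (finv (@corner_pred g) c); apply: f_finv corner_pred_inj _. Qed.

Lemma slot_pred_surj (u : slot) : exists v, slot_pred b v = u.
Proof.
exists (finv (slot_pred b) u); apply: f_finv.
exact: slot_pred_inj.
Qed.

Lemma perm_surj (s : {perm slot}) (u : slot) : exists v, s v = u.
Proof. by exists ((s^-1)%g u); rewrite permKV. Qed.

Lemma slot_tag_surj (x : vert g) : exists u, tg u = x.
Proof.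
have lt0 : (0 < valence x)%N by apply: leq_trans (admissible_ge3 x).
by exists (Some (to_corner (Ordinal lt0))).
Qed.

Lemma card_slot_half : #|{: slot_half g}| = (2 * (#|edges g| + 1 + #|{: slot}|))%N.
Proof. by rewrite !card_sum card_prod card_bool card_half [(_ * 2)%N]mulnC !mulnDr. Qed.

Lemma connect_slot_half (i : slot_half g -> slot) h u v :
  i h = u -> i (slot_opp h) = v -> connect (@adj (slot_graph i)) u v.
Proof. by move=> <- <-; apply: (@connect_half (slot_graph i)). Qed.

Lemma connected_X s : s \in slot_perms b -> connected (slot_graph (incX s)).
Proof.
move=> /slot_permsP sP; apply: (@connected_over g (slot_graph (incX s)) tg) => //.
- exact: (proj1 g_adm).
- apply: (connect_descent (p := ps)); first exact: (@connect_adjC (slot_graph _)).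
    move=> u pn0; exists (slot_pred b u); rewrite slot_tag_pred; split=> //.
      by rewrite slot_pos_pred (negPf pn0) prednK // lt0n.
    exact: (@connect_slot_half _ (inr (u, true))).
  by move=> u v tuv pu pv; apply: (slot_pos_inj tuv); rewrite pu pv.
- exact: slot_tag_surj.
move=> h; exists (s (Some (half_corner o h))), (s (Some (half_corner o (opp h)))).
by rewrite !sP; split=> //; apply: (@connect_slot_half _ (inl (inl h))).
Qed.

Lemma connected_Z s : s \in slot_perms b -> connected (slot_graph (incZ s)).
Proof.
move=> /slot_permsP sP; apply: (@connected_over g (slot_graph (incZ s)) tg) => //.
- exact: (proj1 g_adm).
- apply: (connect_descent (p := ps)); first exact: (@connect_adjC (slot_graph _)).
    move=> [c|] pn0; last first.
      exists (Some b); rewrite slot_pos_None -slot_pos_base; split=> //.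
      exact: (@connect_slot_half _ (inl (inr true))).
    exists (Some (corner_pred c)); split=> //.
      by rewrite slot_pos_corner_pred (negPf pn0) prednK // lt0n.
    exact: (@connect_slot_half _ (inr (Some c, true))).
  by move=> u v tuv pu pv; apply: (slot_pos_inj tuv); rewrite pu pv.
- exact: slot_tag_surj.
move=> h; exists (s (Some (half_corner o h))), (s (Some (half_corner o (opp h)))).
by rewrite !sP; split=> //; apply: (@connect_slot_half _ (inl (inl h))).
Qed.

Lemma valence_X s u : (3 <= @valence (slot_graph (incX s)) u)%N.
Proof.
have [v ev] := slot_pred_surj u; have [w ew] := perm_surj s u.
case: w ew => [c|] ew.
  have [h eh] := half_of_corner c.
  apply: (@leq3_valence (slot_graph (incX s)) u (inr (u, true)) (inr (v, false)) (inl (inl h))) => //=; by rewrite ?eh ?ev.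
apply: (@leq3_valence (slot_graph (incX s)) u (inr (u, true)) (inr (v, false)) (inl (inr true))) => //=.
Qed.

(** The hypothesis provides the middle of the loop with a half-edge of [g]. *)
Lemma valence_Z (s : {perm slot}) u : s None != None ->
  (3 <= @valence (slot_graph (incZ s)) u)%N.
Proof.
move=> sN; have [w ew] := perm_surj s u.
case: u ew => [c|] ew.
  have [v ev] := corner_pred_surj c.
  case: w ew => [c'|] ew.
    have [h eh] := half_of_corner c'.
    apply: (@leq3_valence (slot_graph (incZ s)) _ (inr (Some c, true)) (inr (Some v, false)) (inl (inl h))) => //=; by rewrite ?eh ?ev.
  apply: (@leq3_valence (slot_graph (incZ s)) _ (inr (Some c, true)) (inr (Some v, false)) (inr (None, false))) => //=; by rewrite ?ev.
case: w ew => [c|] ew; last by rewrite ew in sN.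
have [h eh] := half_of_corner c.
apply: (@leq3_valence (slot_graph (incZ s)) _ (inr (None, true)) (inl (inr true)) (inl (inl h))) => //=; by rewrite ?eh.
Qed.

(** The distance from [q] forward to [p] on an n-gon. If the edge [q] is deleted, every other edge
    goes down from its final to its initial vertex. *)
Definition cyclic_rank (n p q : nat) : nat := if (q <= p)%N then (p - q)%N else (p + n - q)%N.

Lemma cyclic_rank_pred n p q : (p < n)%N -> (q < n)%N -> p != q ->
  (cyclic_rank n (if p == 0%N then n.-1 else p.-1) q < cyclic_rank n p q)%N.
Proof. by rewrite /cyclic_rank; do ![case: ifP]; lia. Qed.

Lemma forest_X s d : d \in choices b -> is_forest (tforest (tripleX o b s d)).
Proof.
move=> dC.
have -> : tforest (tripleX o b s d) =
    [seq @edge (slot_graph (incX s)) (inr (u, true)) | u <- kept b d].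
  by apply: eq_map => u; rewrite /slot_edge -edge_opp.
apply: (@is_forest_parent (slot_graph (incX s)) _ _ _
  (fun u => cyclic_rank (block_size b (tg u)) (ps u) (ps (d (tg u))))).
- exact: kept_uniq.
- by move=> u v _ _.
move=> u; rewrite mem_kept /= slot_tag_pred slot_pos_pred => u_d.
apply: cyclic_rank_pred; first exact: slot_pos_lt.
  by rewrite -{2}(choicesP _ _ dC (tg u)) slot_pos_lt.
by apply: contra u_d => e; rewrite (slot_eqE b) e (choicesP _ _ dC) eqxx.
Qed.

Lemma forest_Z s d (F : slot -> {set half (slot_graph (incZ s))}) :
  d \in choices b -> d (tag b) != None -> s \in slot_perms b -> s None != None ->
  F = slot_edge (incZ s) \/ F = labelZ (incZ s) ->
  is_forest [seq F u | u <- kept b d].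
Proof.
move=> dC d_b /slot_permsP sP sN eF.
pose c (u : slot) : half (slot_graph (incZ s)) :=
  if u is None then
    if F None == loop_edge (incZ s) then inl (inr true) else inr (None, true)
  else inr (u, true).
have -> : [seq F u | u <- kept b d] = [seq edge (c u) | u <- kept b d].
  apply: eq_map => -[v|]; rewrite /c.
    by case: eF => ->; rewrite /labelZ /= /slot_edge -edge_opp.
  case: eqP => [->|ne]; first by rewrite /loop_edge -edge_opp.
  case: eF ne => -> ne; last by case: ne.
  by rewrite /slot_edge -edge_opp.
(* Ranks on the k-gon stay below [k], so the middle of the loop can be placed above all of its
   corners. *)
pose rank (u : slot) := if u is Some c then
  cyclic_rank (valence (tag c)) (ps u) (ps (d (tag c))) else k.
have rank_lt v : tg (Some v) = tag b -> (rank (Some v) < k)%N.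
  move=> /= tv; have := slot_pos_Some_lt b v; rewrite tv.
  by rewrite /cyclic_rank; case: ifP; lia.
apply: (@is_forest_parent (slot_graph (incZ s)) _ _ c rank).
- exact: kept_uniq.
- by move=> [u|] [v|] _ _ //=; rewrite /c; case: ifP.
move=> [v|]; rewrite mem_kept /= => v_d; last first.
  case: ifP => _ /=; first exact: rank_lt.
  case e : (s None) sN => [v|] // _; apply: rank_lt.
  by rewrite -e sP.
rewrite slot_pos_corner_pred.
apply: cyclic_rank_pred; first exact: slot_pos_Some_lt.
  have := choicesP _ _ dC (tag v); case e : (d (tag v)) => [w|] /= tw.
    by rewrite -tw slot_pos_Some_lt.
  by move: d_b; rewrite tw e.
by apply: contra v_d => e; rewrite (slot_eqE b) e (choicesP _ _ dC) eqxx.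
Qed.

Lemma sum_block_size : (\sum_(x : vert g) (block_size b x).-1 =
  (\sum_(x : vert g) (valence x - 1)).+1)%N.
Proof.
rewrite (bigD1 (tag b)) //= [in RHS](bigD1 (tag b)) //= block_size_base.
have := admissible_ge3 (tag b) => k_ge3.
rewrite (eq_bigr (fun x => valence x - 1)%N); last first.
  by move=> x x_b; rewrite /block_size (negPf x_b) addn0 subn1.
by rewrite /= -addSn subn1 prednK // (leq_trans _ k_ge3).
Qed.

Let n := (#|edges g| + 1)%N.
Let m := (\sum_(x : vert g) (valence x - 1))%N.

Lemma betti1_slot_graph (i : slot_half g -> slot) :
  connected (slot_graph i) -> betti1 (slot_graph i) = n.+1.
Proof.
move=> i_conn; rewrite (betti1_half i_conn card_slot_half (erefl #|{: slot}|)) /n.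
lia.
Qed.

Lemma generator_X s d : s \in slot_perms b -> d \in choices b ->
  generator n.+1 m.+1 (tripleX o b s d).
Proof.
move=> sP dC; have conn := connected_X sP; split=> //=.
- exact: betti1_slot_graph.
- by move=> x; have := valence_X (s := s) x; case: ifP => // _ /ltnW.
- exact: forest_X.
by rewrite size_map size_kept // sum_block_size.
Qed.

Lemma generator_Z s d (F : {perm slot} -> slot -> {set slot_half g}) :
  s \in slot_perms b -> s None != None -> d \in choices b -> d (tag b) != None ->
  F s = slot_edge (incZ s) \/ F s = labelZ (incZ s) ->
  generator n.+1 m.+1 (tripleZ o b F s d).
Proof.
move=> sP sN dC d_b eF; have conn := connected_Z sP; split=> //=.
- exact: betti1_slot_graph.
- by move=> x; have := valence_Z x sN; case: ifP => // _ /ltnW.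
- exact: forest_Z.
by rewrite size_map size_kept // sum_block_size.
Qed.

Lemma connected_stab s :
  connected (@add_loop (polygon_graph o s) b).
Proof.
apply: (@connected_over g (@add_loop (polygon_graph o s) b) (@tag _ _)) => //.
- exact: (proj1 g_adm).
- apply: (connect_descent (p := fun c => ps (Some c))); first exact: (@connect_adjC (@add_loop (polygon_graph o s) b)).
    move=> c pn0; exists (corner_pred c); split=> //.
      by rewrite slot_pos_corner_pred (negPf pn0) prednK // lt0n.
    exact: (@connect_half (@add_loop (polygon_graph o s) b) (inl (inr (c, true)))).
  move=> u v tuv pu pv; suff [] : Some u = Some v by [].
  by apply: (slot_pos_inj (b := b)); rewrite // pu pv.
- by move=> x; have lt0 := leq_trans (isT : (0 < 3)%N) (admissible_ge3 x);
    exists (to_corner (Ordinal lt0)).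
move=> h; pose h' : half (@add_loop (polygon_graph o s) b) := inl (inl h).
by exists (inc h'), (inc (opp h')); split=> //; apply: connect_half.
Qed.

Lemma valence_stab s c : (3 <= @valence (@add_loop (polygon_graph o s) b) c)%N.
Proof.
have [v ev] := corner_pred_surj c; have [[c'|] ew] := perm_surj (perm_of s) (Some c).
  have [h eh] := half_of_corner c'.
  apply: (@leq3_valence (@add_loop (polygon_graph o s) b) c (inl (inr (c, true))) (inl (inr (v, false))) (inl (inl h))) => //=.
  by move: ew; rewrite -eh perm_of_Some => -[].
by rewrite perm_of_None in ew.
Qed.

Lemma forest_stab s d :
  is_forest (tforest (stab_triple (@Triple (polygon_graph o s) b (maximal_forest o s d)))).
Proof.
rewrite /= /maximal_forest -map_comp.
set M := filter _ _; pose G := @add_loop (polygon_graph o s) b.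
have -> : [seq (fun e => [set inl h | h in (e : {set half (polygon_graph o s)})]
     : {set half G}) (polygon_edge o s c) | c : corner g <- M] =
  [seq @edge G (inl (inr (c, true))) | c : corner g <- M].
  apply: eq_map => c; rewrite /polygon_edge -edge_opp /edge.
  by rewrite imsetU1 imset_set1.
apply: (@is_forest_parent G _ M (fun c => inl (inr (c, true)))
  (fun c => cyclic_rank (valence (tag c)) (ps (Some c)) (ps (to_slot (d (tag c)))))).
- rewrite filter_uniq // allpairs_uniq_dep ?enum_uniq // => [x _|[x i] [y j] _ _ /= e].
    exact: enum_uniq.
  exact: e.
- by move=> u v _ _.
move=> c; rewrite mem_filter => /andP[c_d _] /=; rewrite slot_pos_corner_pred.
apply: cyclic_rank_pred; [exact: slot_pos_Some_lt|exact: slot_pos_Some_lt|].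
apply: contra c_d => /eqP e.
have : Some c = to_slot (d (tag c)) by apply: (slot_pos_inj (b := b)).
by rewrite -{1}(to_corner_tagged c) => -[] /to_corner_inj ->.
Qed.

Lemma size_maximal_forest s d : size (maximal_forest o s d) = m.
Proof.
rewrite /maximal_forest size_map /m -big_enum /=.
elim: (enum (vert g)) => [|x r IHr] /=; first by rewrite big_nil.
rewrite big_cons filter_cat size_cat IHr filter_map size_map; congr addn.
have := @size_filter_neq _ (enum 'I_(valence x)) (d x) (enum_uniq _) (mem_enum _ _).
by rewrite size_enum_ord subn1.
Qed.

Lemma generator_stab s d : generator n.+1 m
  (stab_triple (@Triple (polygon_graph o s) b (maximal_forest o s d))).
Proof.
have conn := connected_stab s; split=> //.
- have e1 : #|half (@add_loop (polygon_graph o s) b)| =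
      (2 * (#|edges g| + 1 + #|{: corner g}|))%N.
    by rewrite !card_sum card_prod card_bool card_half [(_ * 2)%N]mulnC !mulnDr addnAC.
  rewrite (betti1_half conn e1 (erefl #|{: corner g}|)) /n; lia.
- by move=> x; have := valence_stab (s := s) x; case: ifP => // _ /ltnW.
- exact: forest_stab.
by rewrite /= size_map size_maximal_forest.
Qed.

End Generators.

(** * The filling chain and its boundary *)

Lemma eval_bd phi c : eval phi (bd c) = \sum_(t <- c) t.1 * eval phi (bd_triple t.2).
Proof. by rewrite eval_flatten; apply: eq_bigr => t _; rewrite eval_scale. Qed.

Lemma Forall_cat (A : Type) (P : A -> Prop) (s t : seq A) :
  List.Forall P s -> List.Forall P t -> List.Forall P (s ++ t).
Proof. by elim: s => //= x s IHs Ps Pt; inversion_clear Ps; constructor; auto. Qed.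

Lemma Forall_allpairs (S T : eqType) (R : Type) (P : R -> Prop) (s : seq S) (t : seq T)
    (f : S -> T -> R) :
  (forall x y, x \in s -> y \in t -> P (f x y)) ->
  List.Forall P [seq f x y | x <- s, y <- t].
Proof.
elim: s => [|x s IHs] Pf /=; first by constructor.
apply: Forall_cat; last by apply: IHs => z y zs; apply: Pf; rewrite inE zs orbT.
have {}Pf y : y \in t -> P (f x y) by apply: Pf; rewrite mem_head.
elim: t Pf {IHs} => [|y t IHt] Pf /=; constructor; first exact/Pf/mem_head.
by apply: IHt => z zt; apply: Pf; rewrite inE zt orbT.
Qed.

Lemma eval_bd_allpairs phi (S T : finType) (A : {pred S}) (B : {pred T})
    (f : S -> T -> rat) (h : S -> T -> triple) :
  eval phi (bd [seq (f x y, h x y) | x <- enum A, y <- enum B]) =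
  \sum_(x in A) \sum_(y in B) f x y * eval phi (bd_triple (h x y)).
Proof.
rewrite eval_bd big_allpairs_dep /= big_enum /=; apply: eq_bigr => x _.
by rewrite big_enum.
Qed.

Section Filling.
Variables (g : graph) (o : vertex_ordering g) (b : corner g).

Definition filling (a : rat) : chain :=
  [seq (a * ((-1) ^+ odd_perm s * sign_choice b d * weight b (s None)), tripleX o b s d)
     | s <- enum (slot_perms b), d <- enum (choices b)] ++
  [seq (a * ((-1) ^+ odd_perm s * sign_choice b d),
        tripleZ o b (fun s => slot_edge (incZ o b s)) s d)
     | s <- enum [pred s in slot_perms b | s None != None],
       d <- enum (choices_in b (@not_None g))] ++
  [seq (- (a * ((-1) ^+ odd_perm s * sign_choice b d)),
        tripleZ o b (fun s => labelZ (incZ o b s)) s d)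
     | s <- enum [pred s in slot_perms b | s None != None],
       d <- enum (choices_in b (@not_None g))].

Lemma eval_bd_filling phi a : invariant phi -> admissible g ->
  eval phi (bd (filling a)) =
  - (a * ((valence (tag b)).-1%:R * (-1) ^+ #|vert g|)) *
    eval phi (stab (zcycle o b)).
Proof.
move=> phi_inv g_adm.
have := sum_bd_total o b (admissible_ge3 g_adm) phi_inv.
rewrite (sum_contractX_stab o b (admissible_odd g_adm) phi_inv) mulrA.
move/(congr1 ( *%R a)); rewrite !mulNr mulrN !mulrA => <-.
rewrite mulrDr !mulr_sumr /filling /bd !map_cat !flatten_cat !eval_cat.
rewrite -!/(bd _) !eval_bd_allpairs; congr (_ + _).
  by apply: eq_bigr => s _; rewrite mulr_sumr; apply: eq_bigr => d _; rewrite !mulrA.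
rewrite -big_split /=; apply: eq_bigr => s _; rewrite -big_split mulr_sumr /=.
apply: eq_bigr => d _.
move: (eval _ (bd_triple (tripleZ o b _ s d))) (_ ^+ _) (sign_choice b d) => x y z.
by move: (eval _ _) => w; ring.
Qed.

Lemma filling_is_chain a : admissible g ->
  is_chain (#|edges g| + 1).+1 (\sum_(x : vert g) (valence x - 1)).+1 (filling a).
Proof.
move=> g_adm; apply: Forall_cat.
  by apply: Forall_allpairs => s d; rewrite !mem_enum; apply: generator_X.
by apply: Forall_cat; apply: Forall_allpairs => s d; rewrite !mem_enum;
  move=> /andP[sP sN]; rewrite choices_in_not_None => /andP[dC d_b];
  apply: generator_Z => //; [left|right].
Qed.

Lemma stab_is_chain : admissible g ->
  is_chain (#|edges g| + 1).+1 (\sum_(x : vert g) (valence x - 1)) (stab (zcycle o b)).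
Proof.
move=> g_adm; rewrite /stab /zcycle map_allpairs.
by apply: Forall_allpairs => s d _ _; apply: generator_stab.
Qed.

End Filling.

Theorem theorem4 (g : graph) (o : vertex_ordering g) (b : corner g) (n i : nat)
    (g_adm : admissible g)
    (n_def : n = (#|edges g| + 1)%N)
    (i_def : i = (\sum_(x : vert g) (valence x - 1))%N) :
  is_boundary n.+1 i (stab (zcycle o b)).
Proof.
subst n i; split; first exact: stab_is_chain.
(* The boundary of [filling o b a] is [- a * c] times the stabilized cycle, which dictates
   [a = - c^-1]. *)
pose c : rat := (valence (tag b)).-1%:R * (-1) ^+ #|vert g|.
have c_neq0 : c != 0.
  rewrite mulf_neq0 ?signr_eq0 // pnatr_eq0.
  by have := admissible_ge3 g_adm (tag b); lia.
exists (filling o b (- c^-1)); first exact: filling_is_chain.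
apply: chain_eqP => phi phi_inv; rewrite eval_bd_filling //.
by rewrite -/c !mulNr opprK mulVf ?mul1r.
Qed.
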